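(* Let $\alpha \geq 1$ be an integer and set \[\psi = \psi(\alpha) = \left\lfloor \frac{5^{\alpha+2}}{24}\right\rfloor +1-\gcd(\alpha,2).\] Then the function $\frac{(1+5x)^{\psi}}{5^{\lfloor \alpha/2 \rfloor}} L_{\alpha}$ is a polynomial in $x$ with integer coefficients, i.e. it lies in $\mathbb{Z}[x]$.
   Context: All functions are treated as formal Laurent series in $q$. For $r\ge1$, $f_r = \prod_{n\ge1}(1-q^{rn})$. Let $x = q\frac{f_2 f_{10}^3}{f_1^3 f_5}$ (the eta-quotient $\eta(2\tau)\eta(10\tau)^3/(\eta(\tau)^3\eta(5\tau))$); since $x = q+O(q^2)$, rational functions in $x$ with denominators powers of $1+5x$ are well-defined Laurent series in $q$. The operator $U_5$ acts by $U_5\left(\sum_{n} a(n)q^n\right) = \sum_{n} a(5n)q^n$. Let $\Phi = q^5 \frac{f_{25}f_{50}^2}{f_1f_2^2}$. Define $L_0 = 1$ and for $\alpha\ge 0$, $L_{\alpha+1} = U_5(\Phi\cdot L_\alpha)$ if $\alpha$ is even and $L_{\alpha+1} = U_5(L_\alpha)$ if $\alpha$ is odd. *)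

(* Defs.v *)
From HB Require Import structures.
From mathcomp Require Import all_boot all_order all_algebra.
From mathcomp Require Import boolp.

Set Implicit Arguments.
Unset Strict Implicit.
Unset Printing Implicit Defensive.

Import GRing.Theory.
Local Open Scope ring_scope.

(* R[[q]].  Every series in play has only nonnegative exponents, and all the
   operations involved (including U_5 and inversion of a series with nonzero
   constant term) preserve this, so the subring R[[q]] of the ring R((q)) of
   formal Laurent series suffices. *)
Record fps (R : Type) := FPS { fpscoef : nat -> R }.

Lemma fpsP (R : Type) (f g : fps R) :
  (forall n, fpscoef f n = fpscoef g n) -> f = g.
Proof. by case: f g => [f] [g] /= /funext ->. Qed.

HB.instance Definition _ (R : Type) := gen_eqMixin (fps R).
HB.instance Definition _ (R : Type) := gen_choiceMixin (fps R).

Definition fps_zero {R : zmodType} : fps R := FPS (fun=> 0).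
Definition fps_opp {R : zmodType} (f : fps R) := FPS (fun n => - fpscoef f n).
Definition fps_add {R : zmodType} (f g : fps R) :=
  FPS (fun n => fpscoef f n + fpscoef g n).

Lemma fps_addA (R : zmodType) : associative (@fps_add R).
Proof. by move=> f g h; apply: fpsP => n /=; rewrite addrA. Qed.
Lemma fps_addC (R : zmodType) : commutative (@fps_add R).
Proof. by move=> f g; apply: fpsP => n /=; rewrite addrC. Qed.
Lemma fps_add0 (R : zmodType) : left_id (@fps_zero R) fps_add.
Proof. by move=> f; apply: fpsP => n /=; rewrite add0r. Qed.
Lemma fps_addN (R : zmodType) : left_inverse (@fps_zero R) fps_opp fps_add.
Proof. by move=> f; apply: fpsP => n /=; rewrite addNr. Qed.

HB.instance Definition _ (R : zmodType) := GRing.isZmodule.Build (fps R)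
  (@fps_addA R) (@fps_addC R) (@fps_add0 R) (@fps_addN R).

Definition fps_one {R : comNzRingType} : fps R := FPS (fun n => (n == 0%N)%:R).
Definition fps_mul {R : comNzRingType} (f g : fps R) :=
  FPS (fun n => \sum_(i < n.+1) fpscoef f i * fpscoef g (n - i)%N).

Definition fps_trunc {R : comNzRingType} m (f : fps R) : {poly R} :=
  \poly_(i < m.+1) fpscoef f i.

Lemma coef_fps_trunc (R : comNzRingType) m (f : fps R) i :
  (i <= m)%N -> (fps_trunc m f)`_i = fpscoef f i.
Proof. by rewrite coef_poly ltnS => ->. Qed.

Lemma fps_mul_trunc (R : comNzRingType) m (f g : fps R) n : (n <= m)%N ->
  fpscoef (fps_mul f g) n = (fps_trunc m f * fps_trunc m g)`_n.
Proof.
move=> nm; rewrite coefM /=; apply: eq_bigr => i _.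
rewrite !coef_fps_trunc //.
- by rewrite (leq_trans (leq_subr _ _)).
- by rewrite (leq_trans _ nm) // -ltnS.
Qed.

Lemma fps_mulC (R : comNzRingType) : commutative (@fps_mul R).
Proof.
by move=> f g; apply: fpsP => n; rewrite !(fps_mul_trunc _ _ (leqnn n)) mulrC.
Qed.

Lemma fps_mulA (R : comNzRingType) : associative (@fps_mul R).
Proof.
move=> f g h; apply: fpsP => n.
transitivity (fps_trunc n f * fps_trunc n g * fps_trunc n h)`_n.
  rewrite -mulrA coefM /=; apply: eq_bigr => i _.
  have lein: (i <= n)%N by rewrite -ltnS.
  by rewrite coef_fps_trunc // -fps_mul_trunc ?leq_subr.
rewrite coefM /=; apply: eq_bigr => i _.
have lein: (i <= n)%N by rewrite -ltnS.
by rewrite (@coef_fps_trunc R n h) ?leq_subr // -fps_mul_trunc.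
Qed.

Lemma fps_mul1 (R : comNzRingType) : left_id (@fps_one R) fps_mul.
Proof.
move=> f; apply: fpsP => n /=.
rewrite big_ord_recl /= mul1r subn0 big1 ?addr0 // => i _.
by rewrite mul0r.
Qed.

Lemma fps_mulDl (R : comNzRingType) :
  left_distributive (@fps_mul R) (@fps_add R).
Proof.
move=> f g h; apply: fpsP => n /=.
by rewrite -big_split /=; apply: eq_bigr => i _; rewrite mulrDl.
Qed.

Lemma fps_one_neq0 (R : comNzRingType) : @fps_one R != 0.
Proof.
apply/eqP => /(congr1 (fun f => fpscoef f 0%N)) /= /eqP.
by rewrite oner_eq0.
Qed.

HB.instance Definition _ (R : comNzRingType) :=
  GRing.Zmodule_isComNzRing.Build (fps R)
    (@fps_mulA R) (@fps_mulC R) (@fps_mul1 R) (@fps_mulDl R) (@fps_one_neq0 R).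

Definition fpsC {R : zmodType} (c : R) : fps R :=
  FPS (fun n => if n == 0%N then c else 0).

Lemma fpscoefCM (R : comNzRingType) (c : R) (f : fps R) n :
  fpscoef (fpsC c * f) n = c * fpscoef f n.
Proof.
rewrite /= big_ord_recl /= subn0 big1 ?addr0 // => i _.
by rewrite mul0r.
Qed.

Lemma fpsCM (R : comNzRingType) (a b : R) : fpsC (a * b) = fpsC a * fpsC b.
Proof. by apply: fpsP => n; rewrite fpscoefCM /=; case: eqP; rewrite ?mulr0. Qed.

Lemma fpsC1 (R : comNzRingType) : fpsC (1 : R) = 1.
Proof. by apply: fpsP => n /=; case: eqP. Qed.

Lemma fpscoefM (R : comNzRingType) (f g : fps R) n :
  fpscoef (f * g) n = \sum_(i < n.+1) fpscoef f i * fpscoef g (n - i)%N.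
Proof. by []. Qed.

Lemma fpscoef1 (R : comNzRingType) n : fpscoef (1 : fps R) n = (n == 0%N)%:R.
Proof. by []. Qed.

Lemma fpscoefD (R : zmodType) (f g : fps R) n :
  fpscoef (f + g) n = fpscoef f n + fpscoef g n.
Proof. by []. Qed.

Lemma fpscoefB (R : zmodType) (f g : fps R) n :
  fpscoef (f - g) n = fpscoef f n - fpscoef g n.
Proof. by []. Qed.

Lemma fpscoefX_lt (R : comNzRingType) (u : fps R) n k :
  fpscoef u 0%N = 0 -> (n < k)%N -> fpscoef (u ^+ k) n = 0.
Proof.
move=> u0; elim: k n => // k IHk n nk.
rewrite exprS fpscoefM big1 // => -[[|i] lti] _ /=; first by rewrite u0 mul0r.
rewrite IHk ?mulr0 //; apply: (@leq_trans n) => //.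
by rewrite ltn_subrL /=; case: n lti {nk}.
Qed.

(* For an invertible constant term a, the inverse is a^-1 times the geometric
   series in 1 - a^-1 f, whose terms of index > n do not affect coefficient n. *)
Definition fps_unit {R : comUnitRingType} : pred (fps R) :=
  fun f => fpscoef f 0%N \is a GRing.unit.
Definition fps_geom {R : comUnitRingType} (f : fps R) (n : nat) : fps R :=
  fpsC (fpscoef f 0%N)^-1 *
    \sum_(k < n.+1) (1 - fpsC (fpscoef f 0%N)^-1 * f) ^+ k.
Definition fps_inv {R : comUnitRingType} (f : fps R) : fps R :=
  if fps_unit f then FPS (fun n => fpscoef (fps_geom f n) n) else f.

Lemma fps_geom_stable (R : comUnitRingType) (f : fps R) n m :
  fps_unit f -> (n <= m)%N -> fpscoef (fps_geom f m) n = fpscoef (fps_geom f n) n.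
Proof.
move=> uf; rewrite /fps_geom !fpscoefCM; set u := 1 - _.
have u0 : fpscoef u 0%N = 0.
  by rewrite /u fpscoefB fpscoefCM mulVr // subrr.
elim: m => [|m IHm]; first by rewrite leqn0 => /eqP ->.
rewrite leq_eqVlt ltnS => /predU1P[->//|nm].
by rewrite big_ord_recr fpscoefD mulrDr IHm // fpscoefX_lt // mulr0 addr0.
Qed.

Lemma fps_mulVr (R : comUnitRingType) :
  {in @fps_unit R, left_inverse 1 fps_inv *%R}.
Proof.
move=> f uf; have {}uf : fps_unit f := uf.
rewrite mulrC /fps_inv uf; apply: fpsP => n; rewrite fpscoefM /=.
transitivity (fpscoef (f * fps_geom f n) n).
  rewrite fpscoefM; apply: eq_bigr => i _.
  by rewrite [in RHS]fps_geom_stable ?leq_subr.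
rewrite /fps_geom mulrCA mulrA; set a := fpsC _ * f.
set u := 1 - a.
have u0 : fpscoef u 0%N = 0.
  by rewrite /u fpscoefB /a fpscoefCM mulVr // subrr.
have -> : a * \sum_(k < n.+1) u ^+ k = 1 - u ^+ n.+1.
  have -> : a = - (u - 1) by rewrite opprB opprD opprK addrA subrr add0r.
  by rewrite mulNr -subrX1 opprB.
by rewrite fpscoefB fpscoefX_lt // subr0.
Qed.

Lemma fps_unitPl (R : comUnitRingType) (f g : fps R) : g * f = 1 -> fps_unit f.
Proof.
move=> /(congr1 (fun h => fpscoef h 0%N)).
rewrite fpscoefM big_ord1 /= => gf1.
by apply/unitrPr; exists (fpscoef g 0%N); rewrite mulrC.
Qed.

Lemma fps_invr_out (R : comUnitRingType) : {in [predC @fps_unit R], fps_inv =1 id}.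
Proof. by move=> f /negbTE uf; rewrite /fps_inv ifF. Qed.

HB.instance Definition _ (R : comUnitRingType) :=
  GRing.ComNzRing_hasMulInverse.Build (fps R)
    (@fps_mulVr R) (@fps_unitPl R) (@fps_invr_out R).

Notation qseries := (fps rat).

Definition q : qseries := FPS (fun n => (n == 1%N)%:R).

(* The infinite product prod_(k >= 1) (1 - q^(r k)) for r >= 1: the factors
   with k > n do not affect coefficient n (see euler_stable). *)
Definition euler_partial (r n : nat) : qseries :=
  \prod_(1 <= k < n.+1) (1 - q ^+ (r * k)).
Definition euler (r : nat) : qseries :=
  FPS (fun n => fpscoef (euler_partial r n) n).

Lemma euler_stable (r n m : nat) : (0 < r)%N -> (n <= m)%N ->
  fpscoef (euler_partial r m) n = fpscoef (euler r) n.
Proof.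
move=> r0; elim: m => [|m IHm]; first by rewrite leqn0 => /eqP ->.
rewrite leq_eqVlt ltnS => /predU1P[->//|nm].
have -> : euler_partial r m.+1 = euler_partial r m * (1 - q ^+ (r * m.+1)).
  by rewrite /euler_partial big_nat_recr.
rewrite mulrBr mulr1 fpscoefB IHm //.
rewrite [X in _ - X]fpscoefM big1 ?subr0 // => i _.
rewrite fpscoefX_lt ?mulr0 //.
by rewrite (leq_ltn_trans (leq_subr _ _)) // (leq_ltn_trans nm) // leq_pmull.
Qed.

Lemma euler_unit (r : nat) : euler r \is a GRing.unit.
Proof. by rewrite unfold_in /= /fps_unit /= /euler_partial big_geq. Qed.

Definition U5 (f : qseries) : qseries := FPS (fun n => fpscoef f (5 * n)%N).

Definition x : qseries := q * (euler 2 * euler 10 ^+ 3 / (euler 1 ^+ 3 * euler 5)).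

Definition Phi : qseries :=
  q ^+ 5 * (euler 25 * euler 50 ^+ 2 / (euler 1 * euler 2 ^+ 2)).

Fixpoint L (alpha : nat) : qseries :=
  if alpha is a.+1 then
    if odd a then U5 (L a) else U5 (Phi * L a)
  else 1.

(* For alpha >= 1 the truncated subtraction is exact. *)
Definition psi (alpha : nat) : nat :=
  (5 ^ (alpha + 2) %/ 24 + 1 - gcdn alpha 2)%N.

Lemma five_unit : (5%:R : qseries) \is a GRing.unit.
Proof.
change (fpscoef (5%:R : qseries) 0%N \is a GRing.unit).
have -> : fpscoef (5%:R : qseries) 0%N = 5%:R by [].
by rewrite unitfE.
Qed.

(* Main.v *)
From HB Require Import structures.
From Stdlib Require Import ZArith.
Require Import Defs.
From mathcomp Require Import all_boot all_order all_algebra all_field.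
From mathcomp Require Import ring zify ssrZ.

(* Write f_r = euler r and let V be q -> q^5.  The pentagonal number theorem and
   Gauss' series for psi = f_2^2 / f_1 give the 5-dissections of f_1, f_2 and psi;
   comparing the sections of f_2^2 = psi f_1 shows that
     f_1 = V(f_5 / r) (1 - u - u^2) and f_2 = V(f_10 / s) (1 - v - v^2),
   where u = q V(r), v = q^2 V(s), s = r(q^2), and that k = q r s^2 satisfies
   s (1 - k) = r^2 (1 + k).  With the product formula for the two theta functions
   in the dissection of psi and the norm of f_1 under q -> zeta q, zeta^5 = 1, this
   yields Ramanujan's parametrization x = k / (1 - 4 k - k^2).  Hence x and Phi
   lie in Q(V(k))(u), where u^5 = V(k ((1 - k) / (1 + k))^2), and U5 is the
   projection to Q(V(k)) followed by V^-1; the modular equation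
   x^5 = sum_(j < 5) A_j(V x) x^j and the values of U5(x^i) and U5(Phi x^i), i < 5,
   become identities between polynomials in k.
   Since 1 + 5 x divides (1 + 5 V x)^5 in Z[x, V x], applying U5 to p(x) / (1 + 5 x)^n
   multiplies the pole order n by 5, and Phi adds 5 to it.  The modular equation also
   propagates lower bounds for the 5-adic valuations of the coefficients of U5(x^m)
   and U5(Phi x^m), so that g -> U5(U5(Phi g)) / 5 preserves the series in Z[[x]]
   whose coefficient of x^m is divisible by 5^(m / 4). *)

Set Implicit Arguments.
Unset Strict Implicit.
Unset Printing Implicit Defensive.

Import GRing.Theory Num.Theory.
Local Open Scope ring_scope.

(** * Formal power series *)

Section FpsTheory.
Variable R : comNzRingType.
Implicit Types (f g h : fps R) (p : {poly R}).

(** The pole order and the power of 5 are bounded independently and meet only in the last proof: a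
    polynomial [P] in [Z[x]] with [x5 ^+ n * L alpha = P(x)] on one side, valuations in [Z[[x]]],
    where [1 + 5 x] is invertible, on the other. Since [x = q + O(q^2)], the coefficients of [P] can
    be read off from its q-expansion one after the other, so the divisibility descends to them. The
    obstacle on the 5-adic side is that [U5] alone gains nothing: [U5 x] is [x] modulo 5. The factor
    5 of a double step is a cancellation: the coefficients of [x], [x^2], [x^3] in [U5 (Phi * g)]
    add up to 0 modulo 5, and this sum is all that the next [U5] sees of them modulo 5. The
    identities between modular functions, which are usually checked at the cusps, are here all
    derived from the Jacobi triple product. It is proved in finite form in an arbitrary commutative
    ring, and infinite sums and products are then compared modulo [q^N]. *)

Definition fpsX : fps R := FPS (fun n => (n == 1%N)%:R).

Lemma fpscoefN f n : fpscoef (- f) n = - fpscoef f n. Proof. by []. Qed.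

Lemma fpscoef_sum (I : Type) (s : seq I) (P : pred I) (F : I -> fps R) n :
  fpscoef (\sum_(i <- s | P i) F i) n = \sum_(i <- s | P i) fpscoef (F i) n.
Proof.
elim: s => [|i s IHs]; first by rewrite !big_nil.
by rewrite !big_cons; case: (P i); rewrite ?fpscoefD IHs.
Qed.

Lemma fpscoefXM f n :
  fpscoef (fpsX * f) n = if n is m.+1 then fpscoef f m else 0.
Proof.
rewrite fpscoefM big_ord_recl mul0r add0r; case: n => [|n]; first by rewrite big_ord0.
rewrite big_ord_recl mul1r subSS subn0 big1 ?addr0 // => i _; exact: mul0r.
Qed.

Lemma fpscoefXnM k f n :
  fpscoef (fpsX ^+ k * f) n = if (n < k)%N then 0 else fpscoef f (n - k).
Proof.
elim: k n => [|k IHk] n; first by rewrite mul1r subn0.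
by rewrite exprS -mulrA fpscoefXM; case: n => [|n] //; rewrite IHk.
Qed.

Lemma fpscoefXn k n : fpscoef (fpsX ^+ k) n = (n == k)%:R.
Proof.
rewrite -[fpsX ^+ k]mulr1 fpscoefXnM fpscoef1; case: ltngtP => [//|kn|->].
  by rewrite subn_eq0 leqNgt kn.
by rewrite subnn.
Qed.

(** Limits are taken through this relation: an infinite product or sum is replaced modulo [q^N] by a
    finite one with enough terms. *)
Definition fps_eqmod N f g := forall n, (n < N)%N -> fpscoef f n = fpscoef g n.

Lemma fps_eqmodP f g : (forall N, fps_eqmod N f g) -> f = g.
Proof. by move=> fg; apply: fpsP => n; apply: (fg n.+1). Qed.

Lemma fps_eqmod_refl N f : fps_eqmod N f f. Proof. by []. Qed.

Lemma fps_eqmod_sym N f g : fps_eqmod N f g -> fps_eqmod N g f.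
Proof. by move=> fg n nN; rewrite fg. Qed.

Lemma fps_eqmod_trans N f g h :
  fps_eqmod N f g -> fps_eqmod N g h -> fps_eqmod N f h.
Proof. by move=> fg gh n nN; rewrite fg ?gh. Qed.

Lemma fps_eqmodD N f f' g g' :
  fps_eqmod N f f' -> fps_eqmod N g g' -> fps_eqmod N (f + g) (f' + g').
Proof. by move=> ff gg n nN; rewrite !fpscoefD ff ?gg. Qed.

Lemma fps_eqmodM N f f' g g' :
  fps_eqmod N f f' -> fps_eqmod N g g' -> fps_eqmod N (f * g) (f' * g').
Proof.
move=> ff gg n nN; rewrite !fpscoefM; apply: eq_bigr => i _.
rewrite ff ?gg //; apply: leq_ltn_trans nN; rewrite ?leq_subr //.
by rewrite -ltnS.
Qed.

Lemma fps_eqmod_expr N k f f' : fps_eqmod N f f' -> fps_eqmod N (f ^+ k) (f' ^+ k).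
Proof.
by move=> ff; elim: k => // k IHk; rewrite !exprS; apply: fps_eqmodM.
Qed.

Lemma fps_eqmod_sum N (I : eqType) (s : seq I) (F G : I -> fps R) :
  (forall i, i \in s -> fps_eqmod N (F i) (G i)) ->
  fps_eqmod N (\sum_(i <- s) F i) (\sum_(i <- s) G i).
Proof.
move=> FG n nN; rewrite !fpscoef_sum !big_seq; apply: eq_bigr => i si.
exact: FG.
Qed.

Lemma fps_eqmod_prod1 N (I : eqType) (s : seq I) (F : I -> fps R) :
  (forall i, i \in s -> fps_eqmod N (F i) 1) ->
  fps_eqmod N (\prod_(i <- s) F i) 1.
Proof.
move=> F1; rewrite big_seq; apply: (big_ind (fun f => fps_eqmod N f 1)) => //.
by move=> f g f1 g1; rewrite -[1]mulr1; apply: fps_eqmodM.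
Qed.

(* The substitution q -> q^d; for d = 0 it is not a morphism. *)
Definition dilate d f : fps R :=
  FPS (fun n => if (d %| n)%N then fpscoef f (n %/ d) else 0).

Definition fps_section r f : fps R := FPS (fun n => fpscoef f (5 * n + r)%N).

Lemma fpscoef_dilate d f n :
  fpscoef (dilate d f) n = if (d %| n)%N then fpscoef f (n %/ d) else 0.
Proof. by []. Qed.

Lemma fpscoef_section r f n : fpscoef (fps_section r f) n = fpscoef f (5 * n + r)%N.
Proof. by []. Qed.

End FpsTheory.

Section Dilate.
Variables (R : comNzRingType) (d : nat).
Implicit Types f g : fps R.
Local Notation V := (@dilate R d.+1).

Lemma dilate_is_zmod : zmod_morphism V.
Proof. by move=> f g; apply: fpsP => n /=; case: ifP; rewrite ?subr0. Qed.

Lemma dilate_is_monoid : monoid_morphism V.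
Proof.
split; first by apply: fpsP => -[|n] //=; case: ifP => // /dvdnP[[|m]] // ->; rewrite mulnK.
move=> f g; apply: fpsP => n.
(* Up to degree [n] the dilation is composition of the truncation with ['X^(d.+1)], which is
   multiplicative on polynomials. *)
pose p (h : fps R) := fps_trunc n h \Po 'X^(d.+1).
have Vp h i : (i <= n)%N -> fpscoef (V h) i = (p h)`_i.
  move=> lein; rewrite /p coef_comp_poly_Xn //=; case: ifP => // _.
  by rewrite coef_fps_trunc // (leq_trans _ lein) // leq_div.
rewrite fpscoefM.
transitivity (p f * p g)`_n; last first.
  rewrite coefM; apply: eq_bigr => i _.
  by rewrite !Vp ?leq_subr // -ltnS.
rewrite -rmorphM /= coef_comp_poly_Xn //; case: ifP => // _.
by rewrite -fps_mul_trunc // leq_div.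
Qed.

HB.instance Definition _ :=
  GRing.isZmodMorphism.Build (fps R) (fps R) V dilate_is_zmod.
HB.instance Definition _ :=
  GRing.isMonoidMorphism.Build (fps R) (fps R) V dilate_is_monoid.

Lemma dilateX : V (fpsX R) = fpsX R ^+ d.+1.
Proof.
apply: fpsP => n; rewrite fpscoefXn /=; case: ifP => [/dvdnP[m ->]|nd].
  by rewrite mulnK // -{2}[d.+1]mul1n eqn_pmul2r.
by case: eqP nd => // ->; rewrite dvdnn.
Qed.

Lemma dilate_inj : injective V.
Proof.
move=> f g /(congr1 (fun h => fpscoef h _)) fg; apply: fpsP => n.
by have /= := fg (n * d.+1)%N; rewrite dvdn_mull // mulnK.
Qed.

Lemma fps_eqmod_dilate N f g : fps_eqmod N f g -> fps_eqmod N (V f) (V g).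
Proof.
move=> fg n nN /=; case: ifP => // _; apply: fg.
by rewrite (leq_ltn_trans _ nN) // leq_div.
Qed.

End Dilate.

Lemma dilate_dilate (R : comNzRingType) c d (f : fps R) :
  (0 < d)%N -> dilate d (dilate c f) = dilate (c * d) f.
Proof.
move=> d0; apply: fpsP => n /=.
have [/dvdnP[m ->]|dn] := boolP (d %| n)%N.
  by rewrite mulnK // dvdn_pmul2r // divnMr.
by case: ifP => // /(dvdn_trans (dvdn_mull c (dvdnn d))); rewrite (negbTE dn).
Qed.

Section Sections.
Variable R : comNzRingType.
Implicit Types f g : fps R.
Local Notation V := (@dilate R 5).
Local Notation sec := (@fps_section R).
Local Notation X := (fpsX R).

Lemma sectionD r f g : sec r (f + g) = sec r f + sec r g.
Proof. exact: fpsP. Qed.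

Lemma section_dilate r s f : (r < 5)%N -> (s < 5)%N ->
  sec r (X ^+ s * V f) = if r == s then f else 0.
Proof.
move=> r5 s5; apply: fpsP => n; rewrite fpscoef_section fpscoefXnM fpscoef_dilate.
case: eqP => [->|rs].
  by rewrite ltnNge leq_addl /= addnK dvdn_mulr // mulKn.
case: ltnP => // sn; case: ifP => //= /dvdnP[m]; lia.
Qed.

Lemma section_decomp f :
  f = V (sec 0 f) + X * V (sec 1 f) + X ^+ 2 * V (sec 2 f)
      + X ^+ 3 * V (sec 3 f) + X ^+ 4 * V (sec 4 f).
Proof.
have E r m s g : (r < 5)%N -> (s < 5)%N ->
    fpscoef (X ^+ s * V g) (5 * m + r) = if r == s then fpscoef g m else 0.
  move=> r5 s5; have := section_dilate g r5 s5.
  by move/(congr1 (fun h => fpscoef h m)); rewrite fpscoef_section => ->; case: eqP.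
apply: fpsP => n; rewrite (divn_eq n 5) mulnC.
have: (n %% 5 < 5)%N by rewrite ltn_mod.
move: (n %% 5)%N (n %/ 5)%N => r m r5; rewrite !fpscoefD.
rewrite -[V (sec 0 f)]mul1r -(expr0 X) -[X in X * V (sec 1 f)]expr1 !E //=.
by case: r r5 => [|[|[|[|[|]]]]] // _; rewrite ?addr0 ?add0r.
Qed.

Lemma section_linear r a f : (r < 5)%N -> sec r (V a * f) = a * sec r f.
Proof.
move=> r5; rewrite {1}(section_decomp f) !mulrDr -!rmorphM /=.
rewrite -[V (a * _)]mul1r -(expr0 X) -{2}(expr1 X).
rewrite ![V a * (_ * _)]mulrCA -!rmorphM /= !sectionD !section_dilate //.
by case: r r5 => [|[|[|[|[|]]]]] // _; rewrite ?addr0 ?add0r.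
Qed.

End Sections.

(** * The Jacobi triple product *)

Section JacobiTripleProduct.
Variable A : comNzRingType.
Implicit Types a b Q : A.

Fixpoint gauss_binom Q (n k : nat) : A :=
  match n, k with
  | _, 0 => 1
  | 0, _.+1 => 0
  | n'.+1, k'.+1 => gauss_binom Q n' k'.+1 + Q ^+ (n' - k') * gauss_binom Q n' k'
  end.

Lemma gauss_binom0 Q n : gauss_binom Q n 0 = 1. Proof. by case: n. Qed.

Lemma gauss_binom_small Q n k : (n < k)%N -> gauss_binom Q n k = 0.
Proof.
elim: n k => [|n IHn] [|k] //= nk.
by rewrite !IHn ?mulr0 ?addr0 // ltnW.
Qed.

Lemma gauss_binomS Q n k : (k <= n)%N ->
  gauss_binom Q n.+1 k.+1 = gauss_binom Q n k.+1 + Q ^+ (n - k) * gauss_binom Q n k.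
Proof. by []. Qed.

Lemma gauss_binomS' Q n k : (k <= n)%N ->
  gauss_binom Q n.+1 k.+1 = gauss_binom Q n k + Q ^+ k.+1 * gauss_binom Q n k.+1.
Proof.
elim: n k => [|n IHn] k kn.
  by move: kn; rewrite leqn0 => /eqP ->; rewrite /= mulr0 addr0 add0r mulr1.
case: k kn => [|k] kn.
  rewrite gauss_binomS // subn0 gauss_binom0 mulr1 [in LHS]IHn //.
  rewrite gauss_binom0 [in RHS]gauss_binomS // subn0 gauss_binom0 !exprS expr0; ring.
rewrite gauss_binomS //.
have [kn'|nk] := leqP k.+1 n; last first.
  have -> : k = n by lia.
  rewrite !(@gauss_binom_small _ _ n.+2) ?subnn //; ring.
rewrite [in LHS](IHn k.+1) // [in LHS](IHn k) 1?ltnW // [gauss_binom Q n.+1 k.+2]gauss_binomS //.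
rewrite [gauss_binom Q n.+1 k.+1]gauss_binomS 1?ltnW //.
have -> : (n.+1 - k.+1 = (n - k.+1).+1)%N by rewrite subSn.
have -> : (n - k = (n - k.+1).+1)%N by rewrite subnSK.
by rewrite !exprS; ring.
Qed.

Lemma gauss_binom_prod Q n k : (k <= n)%N ->
  gauss_binom Q n k * \prod_(1 <= i < k.+1) (1 - Q ^+ i)
    = \prod_(0 <= i < k) (1 - Q ^+ (n - i)).
Proof.
elim: n k => [|n IHn] [|k] // kn; try by rewrite gauss_binom0 !big_geq ?mulr1.
rewrite big_nat_recr // [in RHS]big_nat_recl // subn0.
under [in RHS]eq_bigr do rewrite subSS.
rewrite -IHn //; have E1 := @gauss_binomS Q n k kn; have E2 := @gauss_binomS' Q n k kn.
(* Subtracting [Q ^+ k.+1] times the first Pascal rule from the second one eliminates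
   [gauss_binom Q n k.+1]. *)
have H : gauss_binom Q n.+1 k.+1 * (1 - Q ^+ k.+1)
         = (1 - Q ^+ n.+1) * gauss_binom Q n k.
  have -> : Q ^+ n.+1 = Q ^+ k.+1 * Q ^+ (n - k) by rewrite -exprD addSn subnKC.
  rewrite mulrBr mulr1 {1}E2 E1; ring.
by rewrite [RHS]mulrA -H -mulrA [X in _ = _ * X]mulrC.
Qed.

(* The term of index j = k - n in the bilateral sum: the truncated
   differences make one formula cover both signs of j. *)
Definition theta_term a b (n k : nat) : A :=
  a ^+ ('C((k - n).+1, 2) + 'C(n - k, 2)) * b ^+ ('C(k - n, 2) + 'C((n - k).+1, 2)).

(** With [j = k - n], consecutive terms have ratio [a (a b)^j]; the powers of [a b] on both sides
    absorb the negative exponents. *)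
Lemma theta_term_shiftl a b m n k : (k <= m + n)%N ->
  a * (a * b) ^+ m * theta_term a b n k = (a * b) ^+ (m + n - k) * theta_term a b n k.+1.
Proof.
move=> kmn; rewrite /theta_term !exprMn.
have E (u v w y z : nat) : (m.+1 + u = w + y /\ m + v = w + z)%N ->
    a * (a ^+ m * b ^+ m) * (a ^+ u * b ^+ v) = a ^+ w * b ^+ w * (a ^+ y * b ^+ z).
  case=> uy vz; transitivity (a ^+ (m.+1 + u) * b ^+ (m + v)).
    by rewrite !exprD exprS; ring.
  by rewrite uy vz !exprD; ring.
apply: E; have [nk|kn] := leqP n k.
  have [i ki] : exists i, (k = n + i)%N by exists (k - n)%N; rewrite subnKC.
  rewrite ki; have -> : (n + i - n = i)%N by lia.
  have -> : (n - (n + i) = 0)%N by lia.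
  have -> : ((n + i).+1 - n = i.+1)%N by lia.
  have -> : (n - (n + i).+1 = 0)%N by lia.
  by rewrite !binS ?bin0 ?bin1 ?bin0n /=; split; lia.
have [i ni] : exists i, (n = k + i.+1)%N by exists (n - k).-1; lia.
rewrite ni; have -> : (k + i.+1 - k = i.+1)%N by lia.
have -> : (k - (k + i.+1) = 0)%N by lia.
have -> : (k.+1 - (k + i.+1) = 0)%N by lia.
have -> : (k + i.+1 - k.+1 = i)%N by lia.
by rewrite !binS ?bin0 ?bin1 ?bin0n /=; split; lia.
Qed.

Lemma theta_term_shiftr a b n k :
  b * (a * b) ^+ n * theta_term a b n k = (a * b) ^+ k * theta_term a b n.+1 k.
Proof.
rewrite /theta_term !exprMn.
have E (u v w y z : nat) : (n + u = w + y /\ n.+1 + v = w + z)%N ->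
    b * (a ^+ n * b ^+ n) * (a ^+ u * b ^+ v) = a ^+ w * b ^+ w * (a ^+ y * b ^+ z).
  case=> uy vz; transitivity (a ^+ (n + u) * b ^+ (n.+1 + v)).
    by rewrite !exprD exprS; ring.
  by rewrite uy vz !exprD; ring.
apply: E; have [kn|nk] := leqP k n.
  have [i ->] : exists i, (n = k + i)%N by exists (n - k)%N; rewrite subnKC.
  have -> : (k + i - k = i)%N by lia.
  have -> : (k - (k + i) = 0)%N by lia.
  have -> : (k - (k + i).+1 = 0)%N by lia.
  have -> : ((k + i).+1 - k = i.+1)%N by lia.
  by rewrite !binS ?bin0 ?bin1 ?bin0n /=; split; lia.
have [i ->] : exists i, (k = n + i.+1)%N by exists (k - n).-1; lia.
have -> : (n + i.+1 - n = i.+1)%N by lia.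
have -> : (n - (n + i.+1) = 0)%N by lia.
have -> : (n.+1 - (n + i.+1) = 0)%N by lia.
have -> : (n + i.+1 - n.+1 = i)%N by lia.
by rewrite !binS ?bin0 ?bin1 ?bin0n /=; split; lia.
Qed.

Lemma theta_termSS a b n k : theta_term a b n.+1 k.+1 = theta_term a b n k.
Proof. by rewrite /theta_term !subSS. Qed.

Lemma theta_term_sum a b M :
  \sum_(0 <= k < (2 * M).+1) theta_term a b M k =
  1 + \sum_(1 <= j < M.+1)
        (a ^+ 'C(j.+1, 2) * b ^+ 'C(j, 2) + a ^+ 'C(j, 2) * b ^+ 'C(j.+1, 2)).
Proof.
elim: M => [|M IHM]; first by rewrite big_nat1 big_geq // /theta_term /= !mulr1 addr0.
rewrite (_ : (2 * M.+1).+1 = (2 * M).+3) ?mulnS // big_nat_recl // big_nat_recr //=.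
under eq_bigr do rewrite theta_termSS.
rewrite {}IHM theta_termSS [in RHS]big_nat_recr //= /theta_term subn0.
have -> : ((2 * M).+1 - M = M.+1)%N by lia.
have -> : (M - (2 * M).+1 = 0)%N by lia.
by rewrite !sub0n bin0n bin_small //= !add0n !addn0 addrCA -!addrA; congr (_ + (_ + _)); exact: addrC.
Qed.

Arguments gauss_binom : simpl never.

(** A form of the q-binomial theorem, with the summation index recentred at [n]. The first Pascal
    rule drives the induction on [m], the second one the induction on [n] for [m = 0]. *)
Lemma finite_triple_product a b m n :
  (\prod_(0 <= i < m) (1 + a * (a * b) ^+ i)) * \prod_(0 <= i < n) (1 + b * (a * b) ^+ i)
  = \sum_(0 <= k < (m + n).+1) gauss_binom (a * b) (m + n) k * theta_term a b n k.
Proof.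
elim: m => [|m IHm].
  rewrite big_geq // mul1r add0n; elim: n => [|n IHn].
    by rewrite big_geq // big_nat1 /theta_term /= !mulr1.
  rewrite big_nat_recr //= {}IHn mulrDr mulr1 [in RHS]big_nat_recl //.
  under [in RHS]eq_big_nat => k /andP[_ kn].
    rewrite (@gauss_binomS' _ n k) // mulrDl theta_termSS; over.
  rewrite big_split /= addrCA; congr (_ + _).
  rewrite [RHS](_ : _ =
      \sum_(0 <= k < n.+2) (a * b) ^+ k * gauss_binom (a * b) n k * theta_term a b n.+1 k).
    rewrite [in RHS]big_nat_recr //= gauss_binom_small // mulr0 mul0r addr0.
    rewrite mulr_suml; apply: eq_bigr => k _.
    by rewrite -mulrA [theta_term _ _ _ _ * _]mulrC theta_term_shiftr mulrCA mulrA.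
  by rewrite [in RHS]big_nat_recl // !gauss_binom0 expr0 !mul1r.
rewrite big_nat_recr //= mulrAC {}IHm mulrDr mulr1 addSn [in RHS]big_nat_recl //.
under [in RHS]eq_big_nat => k /andP[_ kn].
  rewrite gauss_binomS // mulrDl; over.
rewrite big_split /= addrA; congr (_ + _).
  rewrite [LHS]big_nat_recl // !gauss_binom0; congr (_ + _).
  by rewrite [in RHS]big_nat_recr //= gauss_binom_small // mul0r addr0.
rewrite mulr_suml; apply: eq_big_nat => k /andP[_ kn].
by rewrite -[RHS]mulrA [RHS]mulrCA -theta_term_shiftl // -[LHS]mulrA; congr (_ * _); exact: mulrC.
Qed.

End JacobiTripleProduct.

Section TripleProductLimit.
Variable R : comNzRingType.
Implicit Types a b f : fps R.

Lemma fps_eqmod_expr0 f k N :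
  fpscoef f 0 = 0 -> (N <= k)%N -> fps_eqmod N (f ^+ k) 0.
Proof. by move=> f0 Nk i iN; apply: fpscoefX_lt => //; apply: leq_trans Nk. Qed.

(** Terms at distance at least [N] from the centre [k = M] vanish modulo [q^N]. For the others,
    [gauss_binom_prod] leaves factors [1 - Q ^+ i] with [i > M - N >= N], which are 1 modulo
    [q^N]. *)
Lemma triple_product a b N M :
  fpscoef a 0 = 0 -> fpscoef b 0 = 0 -> (2 * N <= M)%N ->
  fps_eqmod N
    ((\prod_(0 <= i < M) (1 + a * (a * b) ^+ i)) * (\prod_(0 <= i < M) (1 + b * (a * b) ^+ i))
      * \prod_(1 <= i < M.+1) (1 - (a * b) ^+ i))
    (1 + \sum_(1 <= j < M.+1)
        (a ^+ 'C(j.+1, 2) * b ^+ 'C(j, 2) + a ^+ 'C(j, 2) * b ^+ 'C(j.+1, 2))).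
Proof.
move=> a0 b0 NM; set Q := a * b.
have Q0 : fpscoef Q 0 = 0 by rewrite fpscoefM big_ord1 a0 mul0r.
have Q1 k : (N <= k)%N -> fps_eqmod N (1 - Q ^+ k) 1.
  by move=> Nk i iN; rewrite fpscoefB (fpscoefX_lt Q0) ?subr0 //; apply: leq_trans Nk.
rewrite -theta_term_sum finite_triple_product addnn -mul2n mulr_suml.
apply: fps_eqmod_sum => k; rewrite mem_index_iota /= ltnS => kM.
have [kN|Nk] := boolP ((M + N <= k) || (k + N <= M))%N.
  suff t0 : fps_eqmod N (theta_term a b M k) 0.
    apply: (fps_eqmod_trans (g := 0)); last exact: fps_eqmod_sym.
    rewrite mulrAC -[0](mulr0 (gauss_binom Q (2 * M) k * \prod_(1 <= i < M.+1) (1 - Q ^+ i))).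
    exact: fps_eqmodM.
  rewrite /theta_term.
  have [kM'|kM'] := leqP M k.
    rewrite -[0](mul0r (b ^+ ('C(k - M, 2) + 'C((M - k).+1, 2)))).
    apply: fps_eqmodM => //; apply: fps_eqmod_expr0 => //.
    have : (k - M <= 'C((k - M).+1, 2))%N by rewrite binS bin1 leq_addl.
    lia.
  rewrite -[0](mulr0 (a ^+ ('C((k - M).+1, 2) + 'C(M - k, 2)))).
  apply: fps_eqmodM => //; apply: fps_eqmod_expr0 => //.
  have : (M - k <= 'C((M - k).+1, 2))%N by rewrite binS bin1 leq_addl.
  lia.
have {}Nk : (k < M + N)%N /\ (M < k + N)%N by lia.
rewrite mulrAC -[X in fps_eqmod _ _ X]mul1r; apply: fps_eqmodM => //.
have prod_le m n : (m <= n)%N -> (N <= m)%N ->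
    fps_eqmod N (\prod_(1 <= i < n.+1) (1 - Q ^+ i)) (\prod_(1 <= i < m.+1) (1 - Q ^+ i)).
  move=> mn Nm; rewrite (@big_cat_nat _ _ _ m.+1) //= -[X in fps_eqmod _ _ X]mulr1.
  apply: fps_eqmodM => //; apply: fps_eqmod_prod1 => i.
  by rewrite mem_index_iota => ?; apply: Q1; lia.
apply: (fps_eqmod_trans (g := gauss_binom Q (2 * M) k * \prod_(1 <= i < k.+1) (1 - Q ^+ i))).
  apply: fps_eqmodM => //; have [Mk|kM'] := leqP M k; last by apply: prod_le; lia.
  by apply/fps_eqmod_sym/prod_le; lia.
rewrite gauss_binom_prod //; apply: fps_eqmod_prod1 => i.
by rewrite mem_index_iota => ?; apply: Q1; lia.
Qed.

End TripleProductLimit.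

(** * Theta series of euler and of psi *)

Lemma qE : q = fpsX rat. Proof. by []. Qed.

Lemma fps_eqmod_qn0 N k : (N <= k)%N -> fps_eqmod N (q ^+ k) 0.
Proof. by move=> Nk; apply: fps_eqmod_expr0. Qed.

Lemma fps_eqmod_section (R : comNzRingType) r N (f g : fps R) : (r < 5)%N ->
  fps_eqmod (5 * N) f g -> fps_eqmod N (fps_section r f) (fps_section r g).
Proof. by move=> r5 fg n nN; apply: fg; lia. Qed.

Lemma euler_partialS r n :
  euler_partial r n.+1 = euler_partial r n * (1 - q ^+ (r * n.+1)).
Proof. exact: big_nat_recr. Qed.

Lemma euler_partial0 r : euler_partial r 0 = 1.
Proof. exact: big_geq. Qed.

Lemma euler_eqmod r N M : (0 < r)%N -> (N <= M)%N ->
  fps_eqmod N (euler r) (euler_partial r M).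
Proof. by move=> r0 NM n nN; rewrite (euler_stable r0) //; lia. Qed.

Lemma dilate_euler d r : (0 < r)%N -> dilate d.+1 (euler r) = euler (d.+1 * r).
Proof.
move=> r0; apply: fps_eqmodP => N.
apply: fps_eqmod_trans (fps_eqmod_dilate d (euler_eqmod r0 (leqnn N))) _.
apply: fps_eqmod_trans (fps_eqmod_sym (euler_eqmod _ (leqnn N))); last by rewrite muln_gt0.
rewrite rmorph_prod; rewrite /euler_partial => n _; congr fpscoef; apply: eq_bigr => i _.
by rewrite rmorphB rmorph1 rmorphXn /= qE dilateX -exprM mulnA.
Qed.

Lemma fps_eqmod_unitl (R : comUnitRingType) N (c f g : fps R) :
  c \is a GRing.unit -> fps_eqmod N (c * f) (c * g) -> fps_eqmod N f g.
Proof.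
by move=> cU fg; rewrite -(mulKr cU f) -(mulKr cU g); apply: fps_eqmodM.
Qed.

Lemma bin2D m n : 'C(m + n, 2) = ('C(m, 2) + 'C(n, 2) + m * n)%N.
Proof.
elim: m => [|m IHm]; first by rewrite mul0n addn0.
by rewrite addSn !binS ?bin1 ?bin0 IHm; lia.
Qed.

Lemma bin2_mulD d l r :
  'C(d * l + r, 2) = (d * d * 'C(l, 2) + ('C(d, 2) + d * r) * l + 'C(r, 2))%N.
Proof.
elim: l r => [|l IHl] r; first by rewrite bin0n !muln0.
rewrite mulnS addnAC addnC IHl bin2D binS bin1; lia.
Qed.

(* The two families of exponents are 'C(j, 2) + 2 'C(j.+1, 2) and
   'C(i.+1, 2) + 2 'C(i, 2), the latter with i = j.+1. *)
Definition pent_partial M : qseries :=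
  \sum_(0 <= j < M) (-1) ^+ j *
    (q ^+ (3 * 'C(j, 2) + 2 * j) - q ^+ (3 * 'C(j, 2) + 4 * j + 1)).

Lemma pent_partialS M : pent_partial M.+1 = pent_partial M +
  (-1) ^+ M * (q ^+ (3 * 'C(M, 2) + 2 * M) - q ^+ (3 * 'C(M, 2) + 4 * M + 1)).
Proof. exact: big_nat_recr. Qed.

(** The left side pairs the index [j] with [- j], while [pent_partial] pairs [- j] with [j + 1]; the
    term of index [- M] is left over. *)
Lemma pent_partial_theta M :
  1 + \sum_(1 <= j < M.+1) ((- q) ^+ 'C(j.+1, 2) * (- q ^+ 2) ^+ 'C(j, 2)
                           + (- q) ^+ 'C(j, 2) * (- q ^+ 2) ^+ 'C(j.+1, 2))
  = pent_partial M + (-1) ^+ M * q ^+ (3 * 'C(M, 2) + 2 * M).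
Proof.
elim: M => [|M IHM]; first by rewrite /pent_partial !big_geq // add0r mul1r expr0 addr0.
rewrite big_nat_recr // addrA {}IHM pent_partialS.
have E u v : (-q) ^+ u * (- q ^+ 2) ^+ v = (-1) ^+ (u + v) * q ^+ (u + 2 * v).
  by rewrite [(- q) ^+ u]exprNn [(- q ^+ 2) ^+ v]exprNn (exprD _ u v) (exprD _ u (2 * v)) exprM mulrACA.
have sgn u v : odd u = odd v -> (-1) ^+ u = (-1) ^+ v :> qseries.
  by move=> uv; rewrite -signr_odd uv signr_odd.
rewrite !E (sgn ('C(M.+2, 2) + 'C(M.+1, 2))%N M.+1); last first.
  by rewrite !binS ?bin1 ?bin0; lia.
rewrite (sgn ('C(M.+1, 2) + 'C(M.+2, 2))%N M.+1); last first.
  by rewrite !binS ?bin1 ?bin0; lia.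
have -> : ('C(M.+2, 2) + 2 * 'C(M.+1, 2) = 3 * 'C(M, 2) + 4 * M + 1)%N.
  by rewrite !binS ?bin1 ?bin0; lia.
have -> : ('C(M.+1, 2) + 2 * 'C(M.+2, 2) = 3 * 'C(M.+1, 2) + 2 * M.+1)%N.
  by rewrite !binS ?bin1 ?bin0; lia.
by rewrite exprS; ring.
Qed.

Lemma pentagonal_number N M : (N <= M)%N -> fps_eqmod N (euler 1) (pent_partial M).
Proof.
(* [triple_product] asks for [2 * N] terms, but those of index at least [N] vanish modulo [q^N]. The
   case treated is [a = - q], [b = - q^2]. *)
suff {M} large M : (2 * N <= M)%N -> fps_eqmod N (euler 1) (pent_partial M).
  move=> NM; apply: (fps_eqmod_trans (large (2 * M)%N _)); first by rewrite leq_mul2l.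
  rewrite /pent_partial (@big_cat_nat _ _ _ M) //=; last by lia.
  rewrite -[X in fps_eqmod _ _ X]addr0; apply: fps_eqmodD => // n nN.
  rewrite fpscoef_sum big_nat big1 // => j /andP[Mj _].
  rewrite -signr_odd fpscoefM big1 // => i _.
  by rewrite fpscoefB !(@fpscoefX_lt _ q) ?subrr ?mulr0 //; lia.
move=> NM; have a0 : fpscoef (- q) 0 = 0 by rewrite fpscoefN oppr0.
have b0 : fpscoef (- q ^+ 2) 0 = 0 by rewrite fpscoefN (@fpscoefX_lt _ q) ?oppr0.
have := triple_product a0 b0 NM; rewrite pent_partial_theta => tp.
have euler3 : (\prod_(0 <= i < M) (1 + - q * (- q * - q ^+ 2) ^+ i))
    * (\prod_(0 <= i < M) (1 + - q ^+ 2 * (- q * - q ^+ 2) ^+ i))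
    * \prod_(1 <= i < M.+1) (1 - (- q * - q ^+ 2) ^+ i) = euler_partial 1 (3 * M).
  have -> : - q * - q ^+ 2 = q ^+ 3 by rewrite mulrNN -exprS.
  elim: {NM tp} M => [|M IHM]; first by rewrite !big_geq ?muln0 ?euler_partial0 ?mulr1.
  rewrite !(@big_nat_recr _ _ _ M) ?(@big_nat_recr _ _ _ M.+1) //=.
  rewrite (_ : 3 * M.+1 = (3 * M).+3)%N ?mulnS // !euler_partialS -{}IHM !mul1n.
  by rewrite -!exprM mulnS !(exprD, exprS); ring.
rewrite euler3 in tp; apply: (fps_eqmod_trans (@euler_eqmod 1 N (3 * M) _ _)) => //; first by lia.
apply: fps_eqmod_trans tp _; rewrite -[X in fps_eqmod _ _ X]addr0.
apply: fps_eqmodD => //; rewrite -[0](mulr0 ((-1) ^+ M)); apply: fps_eqmodM => //.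
by apply: fps_eqmod_qn0; lia.
Qed.

Definition gauss_psi : qseries := euler 2 ^+ 2 / euler 1.

(** The triple product at [a = q], [b = q^3]: its exponents [2 j^2 - j] and [2 j^2 + j] exhaust the
    triangular numbers. Both sides are multiplied by [f_1 f_4] to avoid quotients of truncated
    products. *)
Lemma gauss_psi_series N M : (N <= M)%N ->
  fps_eqmod N gauss_psi (\sum_(0 <= i < M) q ^+ ('C(i, 2) + i)).
Proof.
suff {M} large M : (2 * N <= M)%N ->
    fps_eqmod N gauss_psi (\sum_(0 <= i < (2 * M).+1) q ^+ ('C(i, 2) + i)).
  move=> NM; apply: (fps_eqmod_trans (large (2 * M)%N _)); first by rewrite leq_mul2l.
  rewrite (@big_cat_nat _ _ _ M) //=; last by lia.
  rewrite -[X in fps_eqmod _ _ X]addr0; apply: fps_eqmodD => // n nN.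
  rewrite fpscoef_sum big_nat big1 // => j /andP[Mj _].
  by rewrite (@fpscoefX_lt _ q) //; lia.
move=> NM; have b0 : fpscoef (q ^+ 3) 0 = 0 by rewrite (@fpscoefX_lt _ q).
have := @triple_product _ q _ N M (erefl _) b0 NM; rewrite -exprS.
have -> : 1 + \sum_(1 <= j < M.+1) (q ^+ 'C(j.+1, 2) * q ^+ 3 ^+ 'C(j, 2)
        + q ^+ 'C(j, 2) * q ^+ 3 ^+ 'C(j.+1, 2)) = \sum_(0 <= i < (2 * M).+1) q ^+ ('C(i, 2) + i).
  elim: {NM} M => [|M IHM]; first by rewrite big_geq // big_nat1 addr0.
  rewrite big_nat_recr // addrA {}IHM (_ : (2 * M.+1).+1 = (2 * M).+3); last by lia.
  rewrite [in RHS]big_nat_recr // [in RHS]big_nat_recr //= -addrA; congr (_ + (_ + _)).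
    rewrite -exprM -exprD; congr (_ ^+ _).
    by rewrite -[(2 * M).+1]addn1 bin2_mulD !binS ?bin1 ?bin0 bin0n /=; lia.
  rewrite -exprM -exprD; congr (_ ^+ _).
  by rewrite -[(2 * M).+2]addn2 bin2_mulD !binS ?bin1 ?bin0 bin0n /=; lia.
move=> tp; apply: (fps_eqmod_unitl (c := euler 1 * euler 4)).
  by rewrite unitrM !euler_unit.
have -> : euler 1 * euler 4 * gauss_psi = euler 2 ^+ 2 * euler 4.
  by rewrite mulrAC [euler 1 * _]mulrCA divrr ?euler_unit // mulr1.
apply: fps_eqmod_sym; set h := (_ * _ : qseries) in tp.
have euler124 : (\prod_(0 <= i < M) (1 + q * q ^+ 4 ^+ i))
    * (\prod_(0 <= i < M) (1 + q ^+ 3 * q ^+ 4 ^+ i))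
    * (euler_partial 4 (2 * M) * euler_partial 1 (4 * M))
  = euler_partial 2 (4 * M) * euler_partial 2 (2 * M).
  elim: {NM tp h} M => [|M IHM]; first by rewrite !big_geq ?muln0 ?euler_partial0 ?mulr1.
  move: IHM; rewrite !(@big_nat_recr _ _ _ M) //=.
  have -> : (2 * M.+1 = (2 * M).+2)%N by lia.
  have -> : (4 * M.+1 = (4 * M).+4)%N by lia.
  rewrite !euler_partialS !mul1n; set y := q ^+ 4 ^+ M.
  move: (\prod_(_ <= _ < _) _) (\prod_(_ <= _ < _) _) => h1 h2.
  move: (euler_partial 4 _) (euler_partial 1 _) (euler_partial 2 _) (euler_partial 2 _).
  move=> p4 p1 p2' p2 IH.
  have E k r m : (m = k * (4 * M) + r)%N -> q ^+ m = y ^+ k * q ^+ r :> qseries.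
    by move=> ->; rewrite exprD mulnC exprM exprM.
  rewrite (E 1 1 (4 * M).+1)%N ?(E 1 2 (4 * M).+2)%N ?(E 1 3 (4 * M).+3)%N ?(E 1 4 (4 * M).+4)%N
    ?(E 2 2 (2 * (4 * M).+1))%N ?(E 2 4 (2 * (4 * M).+2))%N ?(E 2 6 (2 * (4 * M).+3))%N
    ?(E 2 8 (2 * (4 * M).+4))%N ?(E 1 2 (2 * (2 * M).+1))%N ?(E 1 4 (2 * (2 * M).+2))%N
    ?(E 2 4 (4 * (2 * M).+1))%N ?(E 2 8 (4 * (2 * M).+2))%N; try lia.
  have -> : forall g1 g2 g3 g4 g5 g6, p2 * g1 * g2 * g3 * g4 * (p2' * g5 * g6)
    = p2 * p2' * (g1 * g2 * g3 * g4 * g5 * g6) by move=> *; ring.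
  rewrite -IH; ring.
apply: (fps_eqmod_trans (fps_eqmodM (fps_eqmod_refl _) (fps_eqmod_sym tp))).
have eu r m : (0 < r)%N -> (N <= m)%N -> fps_eqmod N (euler r) (euler_partial r m).
  exact: euler_eqmod.
have P4 : \prod_(1 <= i < M.+1) (1 - q ^+ 4 ^+ i) = euler_partial 4 M.
  by apply: eq_bigr => i _; rewrite exprM.
rewrite /h P4; move: euler124; set hh := (X in X * _ = _) => euler124.
apply: (fps_eqmod_trans (g := euler_partial 1 (4 * M) * euler_partial 4 (2 * M) * (hh * euler 4))).
  by do ?apply: fps_eqmodM => //; [apply: eu|apply: eu|apply/fps_eqmod_sym/eu]; lia.
rewrite mulrA [_ * hh]mulrC [euler_partial 1 _ * _]mulrC euler124.
by do ?apply: fps_eqmodM => //; apply/fps_eqmod_sym/eu; lia.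
Qed.

(** * 5-dissections *)

Local Notation V := (dilate 5).
Local Notation W := (dilate 2).
Local Notation sec := fps_section.

Lemma dilateqXn d n : dilate d.+1 (q ^+ n) = q ^+ (d.+1 * n).
Proof. by rewrite rmorphXn /= qE dilateX exprM. Qed.

Lemma big_nat_mul5 (F : nat -> qseries) M :
  \sum_(0 <= i < 5 * M) F i = \sum_(0 <= l < M)
    (F (5 * l + 0)%N + F (5 * l + 1)%N + F (5 * l + 2)%N + F (5 * l + 3)%N + F (5 * l + 4)%N).
Proof.
elim: M => [|M IHM]; first by rewrite !big_geq.
rewrite (_ : 5 * M.+1 = (5 * M).+4.+1)%N; last by lia.
by rewrite !big_nat_recr //= IHM !addrA addn0 addn1 addn2 addn3 addn4.
Qed.

(** The triangular number of [5 l + r] is 0, 1, 3, 1, 0 modulo 5 for [r = 0, ..., 4]. For [r = 2] it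
    is 3 plus 25 times that of [l], so this class reproduces the series itself. *)
Lemma gauss_psi_dissection M :
  \sum_(0 <= i < 5 * M) q ^+ ('C(i, 2) + i) =
    V (\sum_(0 <= l < M) (q ^+ (5 * 'C(l, 2) + 3 * l) + q ^+ (5 * 'C(l, 2) + 7 * l + 2)))
  + q * V (\sum_(0 <= l < M) (q ^+ (5 * 'C(l, 2) + 4 * l) + q ^+ (5 * 'C(l, 2) + 6 * l + 1)))
  + q ^+ 3 * V (V (\sum_(0 <= l < M) q ^+ ('C(l, 2) + l))).
Proof.
rewrite big_nat_mul5 !rmorph_sum /= !mulr_sumr -!big_split /=; apply: eq_bigr => l _.
rewrite !rmorphD /= !dilateqXn mulrDr -exprS -!exprD !bin2_mulD !binS ?bin1 ?bin0 ?bin0n /=.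
rewrite -exprS; set c := 'C(l, 2).
have E (u v w y z u' v' w' y' z' : nat) : u = u' -> v = v' -> w = w' -> y = y' -> z = z' ->
   q ^+ u + q ^+ v + q ^+ w + q ^+ y + q ^+ z
   = q ^+ u' + q ^+ z' + (q ^+ v' + q ^+ y') + q ^+ w' :> qseries.
  by move=> -> -> -> -> ->; ring.
by apply: E; lia.
Qed.

(** Generalized pentagonal numbers are 0, 1 or 2 modulo 5, and the class 1 reproduces the series in
    [q^25]. [A] and [B] stay existential; the relation between their limits is [pent2_rr]. *)
Lemma pent_dissection M : exists A B : qseries,
  pent_partial (5 * M) = V A - q * V (V (pent_partial M)) + q ^+ 2 * V B.
Proof.
pose A l : qseries := (-1) ^+ l * (q ^+ (15 * 'C(l, 2) + 8 * l) + q ^+ (15 * 'C(l, 2) + 13 * l + 1)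
    - q ^+ (15 * 'C(l, 2) + 17 * l + 3) - q ^+ (15 * 'C(l, 2) + 22 * l + 7)).
pose B l : qseries := (-1) ^+ l * (q ^+ (15 * 'C(l, 2) + 14 * l + 1) - q ^+ (15 * 'C(l, 2) + 11 * l)
    + q ^+ (15 * 'C(l, 2) + 19 * l + 4) - q ^+ (15 * 'C(l, 2) + 16 * l + 2)).
exists (\sum_(0 <= l < M) A l), (\sum_(0 <= l < M) B l).
rewrite /pent_partial big_nat_mul5 !rmorph_sum /= !mulr_sumr -sumrB -big_split /=.
apply: eq_bigr => l _; rewrite /A /B !rmorphM !rmorphXn !rmorphN1 /=.
rewrite !(rmorphD, rmorphN) /= !dilateqXn.
have s r : (-1) ^+ (5 * l + r) = (-1) ^+ l * (-1) ^+ r :> qseries.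
  by rewrite exprD exprM -[(-1) ^+ 5]signr_odd expr1.
rewrite !s !bin2_mulD !binS ?bin1 ?bin0 ?bin0n /=; set c := 'C(l, 2).
move: ((-1) ^+ l) => w.
have E (a0 b0 a1 b1 a2 b2 a3 b3 a4 b4 a0' b0' a1' b1' a2' b2' a3' b3' a4' b4' : nat) :
    a0 = a0' -> b0 = b0'.+1 -> a1 = a1'.+2 -> b1 = b1' -> a2 = a2'.+2 -> b2 = b2'.+2 ->
    a3 = a3' -> b3 = b3'.+2 -> a4 = a4'.+1 -> b4 = b4' ->
    w * (-1) ^+ 0 * (q ^+ a0 - q ^+ b0) + w * (-1) ^+ 1 * (q ^+ a1 - q ^+ b1)
    + w * (-1) ^+ 2 * (q ^+ a2 - q ^+ b2) + w * (-1) ^+ 3 * (q ^+ a3 - q ^+ b3)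
    + w * (-1) ^+ 4 * (q ^+ a4 - q ^+ b4)
    = w * (q ^+ a0' + q ^+ b1' - q ^+ a3' - q ^+ b4') - q * (w * (q ^+ b0' - q ^+ a4'))
    + q ^+ 2 * (w * (q ^+ a2' - q ^+ a1' + q ^+ b3' - q ^+ b2')) :> qseries.
  by do 10!move=> ->; rewrite !exprS; ring.
by apply: E; lia.
Qed.

Lemma section_combination r (a b c d e : qseries) : (r < 5)%N ->
  sec r (V a + q * V b + q ^+ 2 * V c + q ^+ 3 * V d + q ^+ 4 * V e) = [:: a; b; c; d; e]`_r.
Proof.
move=> r5; rewrite -[V a]mul1r -(expr0 q) -{2}(expr1 q) !sectionD !section_dilate //.
by case: r r5 => [|[|[|[|[|]]]]] // _ /=; rewrite ?addr0 ?add0r.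
Qed.

Definition pent0 : qseries := sec 0 (euler 1).
Definition pent2 : qseries := sec 2 (euler 1).
Definition psi0 : qseries := sec 0 gauss_psi.
Definition psi1 : qseries := sec 1 gauss_psi.

Lemma euler1_dissection : euler 1 = V pent0 - q * V (euler 5) + q ^+ 2 * V pent2.
Proof.
have pm N := @pentagonal_number (5 * N) (5 * N) (leqnn _).
have sec_r r f : (r < 5)%N ->
    (forall N, fps_eqmod N (sec r (pent_partial (5 * N))) f) -> sec r (euler 1) = f.
  move=> r5 rf; apply: fps_eqmodP => N.
  exact: fps_eqmod_trans (fps_eqmod_section r5 (pm N)) (rf N).
have part r N : exists A B, (r < 5)%N ->
    sec r (pent_partial (5 * N)) = [:: A; - V (pent_partial N); B; 0; 0]`_r.
  have [A [B ->]] := pent_dissection N; exists A, B => r5.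
  rewrite -(section_combination _ _ _ _ _ r5); congr (sec r _).
  by rewrite rmorphN rmorph0 /=; ring.
rewrite {1}(section_decomp (euler 1)) -/pent0 -/pent2.
rewrite (sec_r 1%N (- euler 5)) // ?(sec_r 3%N 0) // ?(sec_r 4%N 0) //; first last.
- move=> N; have [A [B ->]] := part 1%N N => //=.
  rewrite -[euler 5](@dilate_euler 4 1) // -[- V _]mulN1r -[- V (euler 1)]mulN1r.
  apply: fps_eqmodM => //; apply/fps_eqmod_dilate/fps_eqmod_sym.
  exact: pentagonal_number.
- by move=> N; have [A [B ->]] := part 3%N N.
- by move=> N; have [A [B ->]] := part 4%N N.
by rewrite rmorphN rmorph0 qE /=; ring.
Qed.

Lemma gauss_psi_sections : gauss_psi = V psi0 + q * V psi1 + q ^+ 3 * V (V gauss_psi).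
Proof.
have pm N := @gauss_psi_series (5 * N) (5 * N) (leqnn _).
have sec_r r f : (r < 5)%N ->
    (forall N, fps_eqmod N (sec r (\sum_(0 <= i < 5 * N) q ^+ ('C(i, 2) + i))) f) ->
    sec r gauss_psi = f.
  move=> r5 rf; apply: fps_eqmodP => N.
  exact: fps_eqmod_trans (fps_eqmod_section r5 (pm N)) (rf N).
have part r N : exists A B, (r < 5)%N ->
    sec r (\sum_(0 <= i < 5 * N) q ^+ ('C(i, 2) + i))
      = [:: A; B; 0; V (\sum_(0 <= i < N) q ^+ ('C(i, 2) + i)); 0]`_r.
  rewrite gauss_psi_dissection; eexists; eexists => r5.
  rewrite -(section_combination _ _ _ _ _ r5) rmorph0 !mulr0 !addr0; reflexivity.
rewrite {1}(section_decomp gauss_psi) -/psi0 -/psi1.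
rewrite (sec_r 2%N 0) // ?(sec_r 3%N (V gauss_psi)) // ?(sec_r 4%N 0) //; first last.
- by move=> N; have [A [B ->]] := part 2%N N.
- move=> N; have [A [B ->]] := part 3%N N => //=.
  by apply/fps_eqmod_dilate/fps_eqmod_sym/gauss_psi_series.
- by move=> N; have [A [B ->]] := part 4%N N.
by rewrite rmorph0 qE /=; ring.
Qed.

Lemma theta5_partial r s M : (r + s = 5)%N ->
  1 + \sum_(1 <= j < M.+1) ((q ^+ r) ^+ 'C(j.+1, 2) * (q ^+ s) ^+ 'C(j, 2)
                           + (q ^+ r) ^+ 'C(j, 2) * (q ^+ s) ^+ 'C(j.+1, 2))
  = \sum_(0 <= l < M) (q ^+ (5 * 'C(l, 2) + r * l) + q ^+ (5 * 'C(l, 2) + (5 + s) * l + s))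
    + q ^+ (5 * 'C(M, 2) + r * M).
Proof.
move=> rs; elim: M => [|M IHM]; first by rewrite !big_geq // muln0 addr0 add0r.
rewrite big_nat_recr // addrA {}IHM [in RHS]big_nat_recr //= -!exprM -!exprD.
have -> : (r * 'C(M.+2, 2) + s * 'C(M.+1, 2) = 5 * 'C(M.+1, 2) + r * M.+1)%N.
  by rewrite !binS ?bin1 ?bin0 -rs; ring.
have -> : (r * 'C(M.+1, 2) + s * 'C(M.+2, 2) = 5 * 'C(M, 2) + (5 + s) * M + s)%N.
  by rewrite !binS ?bin1 ?bin0 -rs; ring.
by ring.
Qed.

Definition theta5_prod r s M : qseries :=
  (\prod_(0 <= i < M) (1 + q ^+ r * q ^+ 5 ^+ i)) * (\prod_(0 <= i < M) (1 + q ^+ s * q ^+ 5 ^+ i)).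

Lemma theta5_product r s N M : (r.+1 + s.+1 = 5)%N -> (2 * N <= M)%N ->
  fps_eqmod N
    (\sum_(0 <= l < M) (q ^+ (5 * 'C(l, 2) + r.+1 * l) + q ^+ (5 * 'C(l, 2) + (5 + s.+1) * l + s.+1)))
    (theta5_prod r.+1 s.+1 M * euler 5).
Proof.
move=> rs NM.
have a0 k : fpscoef (q ^+ k.+1) 0 = 0 by rewrite (@fpscoefX_lt _ q).
have := triple_product (a0 r) (a0 s) NM; rewrite -exprD theta5_partial // rs => tp.
apply: fps_eqmod_trans (fps_eqmod_trans (fps_eqmod_sym tp) _).
  rewrite -[X in fps_eqmod _ X]addr0; apply: fps_eqmodD => //.
  by apply/fps_eqmod_sym/fps_eqmod_qn0; lia.
apply: fps_eqmodM => //.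
have -> : \prod_(1 <= i < M.+1) (1 - q ^+ 5 ^+ i) = euler_partial 5 M.
  by apply: eq_bigr => i _; rewrite exprM.
by apply/fps_eqmod_sym/euler_eqmod; lia.
Qed.

(** The residues 1, 2, 3, 4 together give the product of [1 + q^n] over [n] prime to 5, that is
    [f_2 f_5 / (f_1 f_10)]. *)
Lemma theta5_prod_euler M :
  theta5_prod 3 2 M * theta5_prod 4 1 M * (euler_partial 1 (5 * M) * euler_partial 10 M)
  = euler_partial 2 (5 * M) * euler_partial 5 M.
Proof.
rewrite /theta5_prod; elim: M => [|M IHM]; first by rewrite !big_geq ?muln0 ?euler_partial0 ?mulr1.
move: IHM; rewrite !(@big_nat_recr _ _ _ M) //=.
have -> : (5 * M.+1 = (5 * M).+4.+1)%N by lia.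
rewrite !euler_partialS !mul1n; set y := q ^+ 5 ^+ M.
move: (\prod_(_ <= _ < _) _) (\prod_(_ <= _ < _) _) (\prod_(_ <= _ < _) _) (\prod_(_ <= _ < _) _).
move: (euler_partial 1 _) (euler_partial 2 _) (euler_partial 5 _) (euler_partial 10 _).
move=> p1 p2 p5 p10 h1 h2 h3 h4 IH.
have E k r m : (m = k * (5 * M) + r)%N -> q ^+ m = y ^+ k * q ^+ r :> qseries.
  by move=> ->; rewrite exprD mulnC exprM exprM.
rewrite (E 1 1 (5 * M).+1)%N ?(E 1 2 (5 * M).+2)%N ?(E 1 3 (5 * M).+3)%N ?(E 1 4 (5 * M).+4)%N
  ?(E 1 5 (5 * M).+4.+1)%N ?(E 2 2 (2 * (5 * M).+1))%N ?(E 2 4 (2 * (5 * M).+2))%N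
  ?(E 2 6 (2 * (5 * M).+3))%N ?(E 2 8 (2 * (5 * M).+4))%N ?(E 2 10 (2 * (5 * M).+4.+1))%N
  ?(E 1 5 (5 * M.+1))%N ?(E 2 10 (10 * M.+1))%N; try lia.
have -> : forall g1 g2 g3 g4 g5 g6, p2 * g1 * g2 * g3 * g4 * g5 * (p5 * g6)
  = p2 * p5 * (g1 * g2 * g3 * g4 * g5 * g6) by move=> *; ring.
by rewrite -IH; ring.
Qed.

(** In Ramanujan's notation [psi0 = f(q^2, q^3)] and [psi1 = f(q, q^4)]; each is a triple product,
    and together they involve every residue prime to 5. *)
Lemma psi0_psi1 : psi0 * psi1 * (euler 1 * euler 10) = euler 2 * euler 5 ^+ 3.
Proof.
apply: fps_eqmodP => N; pose M := (2 * N)%N.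
have pm := @gauss_psi_series (5 * N) (5 * M) _; rewrite gauss_psi_dissection in pm.
set s0 := \sum_(_ <= _ < _) (_ + _) in pm; set s1 := \sum_(_ <= _ < _) (_ + _) in pm.
have {}pm r : (r < 5)%N ->
    fps_eqmod N (sec r gauss_psi) ([:: s0; s1; 0; V (\sum_(0 <= l < M) q ^+ ('C(l, 2) + l)); 0]`_r).
  move=> r5; rewrite -(section_combination _ _ _ _ _ r5) rmorph0 !mulr0 !addr0.
  by apply: fps_eqmod_section => //; apply: pm; rewrite leq_mul2l /M; lia.
have p0 : fps_eqmod N psi0 (theta5_prod 3 2 M * euler 5).
  exact: fps_eqmod_trans (pm 0%N isT) (@theta5_product 2 1 N M _ _).
have p1 : fps_eqmod N psi1 (theta5_prod 4 1 M * euler 5).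
  exact: fps_eqmod_trans (pm 1%N isT) (@theta5_product 3 0 N M _ _).
have eu r m : (0 < r)%N -> (N <= m)%N -> fps_eqmod N (euler r) (euler_partial r m).
  exact: euler_eqmod.
apply: (fps_eqmod_trans (g := theta5_prod 3 2 M * theta5_prod 4 1 M
    * (euler_partial 1 (5 * M) * euler_partial 10 M) * euler 5 ^+ 2)).
  rewrite [X in fps_eqmod _ _ X](_ : _ = theta5_prod 3 2 M * euler 5 * (theta5_prod 4 1 M * euler 5)
    * (euler_partial 1 (5 * M) * euler_partial 10 M)); last by ring.
  by do ?apply: fps_eqmodM => //; apply: eu; rewrite /M; lia.
rewrite theta5_prod_euler -mulrA exprS; apply: fps_eqmodM.
  by apply/fps_eqmod_sym/eu; rewrite /M; lia.
by apply: fps_eqmodM => //; apply/fps_eqmod_sym/eu; rewrite /M; lia.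
Qed.

(** * The norm of euler 1 *)

Section Norm.
Variables (A : comNzRingType) (z : A).
Hypothesis z_root : 1 + z + z ^+ 2 + z ^+ 3 + z ^+ 4 = 0.

Let zE : z ^+ 4 = - (1 + z + z ^+ 2 + z ^+ 3).
Proof. by apply/eqP; rewrite -addr_eq0 addrC z_root. Qed.

Let z5 : z ^+ 5 = 1.
Proof. by apply/eqP; rewrite -subr_eq0 subrX1 !big_ord_recr big_ord0 /= add0r expr0 expr1 z_root mulr0. Qed.

Let a := z + z ^+ 4.
Let b := z ^+ 2 + z ^+ 3.
Let abD : b = - 1 - a.
Proof. by rewrite /a /b zE; ring. Qed.
Let aE : a ^+ 2 + a - 1 = 0.
Proof.
have -> : a ^+ 2 + a - 1 = z ^+ 2 + z ^+ 5 * (2%:R + z ^+ 3) + z + z ^+ 4 - 1 by rewrite /a; ring.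
by rewrite z5 zE; ring.
Qed.

Lemma norm5_1sub y : \prod_(0 <= i < 5) (1 - z ^+ i * y) = 1 - y ^+ 5.
Proof.
rewrite !big_nat_recr //= big_geq // mul1r expr0 mul1r expr1.
transitivity ((1 - y) * (1 - a * y + z ^+ 5 * y ^+ 2) * (1 - b * y + z ^+ 5 * y ^+ 2)).
  by rewrite /a /b; ring.
rewrite z5 abD !mul1r.
have -> : (1 - y) * (1 - a * y + y ^+ 2) * (1 - (- 1 - a) * y + y ^+ 2)
   = 1 - y ^+ 5 - (a ^+ 2 + a - 1) * (y ^+ 2 - y ^+ 3) by ring.
by rewrite aE mul0r subr0.
Qed.

(** Grouping the factors of [i] and [5 - i] leaves only the periods [a = z + z^4] and
    [b = z^2 + z^3], the roots of [t^2 + t - 1]. *)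
Lemma norm5_quadratic y :
  \prod_(0 <= i < 5) (1 - z ^+ i * y - (z ^+ i * y) ^+ 2) = 1 - 11%:R * y ^+ 5 - y ^+ 10.
Proof.
rewrite !big_nat_recr //= big_geq // mul1r expr0 mul1r expr1.
transitivity ((1 - y - y ^+ 2)
  * (1 - a * y + (z ^+ 5 - (z ^+ 2 + z ^+ 5 * z ^+ 3)) * y ^+ 2
     + (z ^+ 5 * z ^+ 4 + z ^+ 5 * z) * y ^+ 3 + z ^+ 5 * z ^+ 5 * y ^+ 4)
  * (1 - b * y + (z ^+ 5 - (z ^+ 4 + z ^+ 5 * z)) * y ^+ 2
     + (z ^+ 5 * z ^+ 3 + z ^+ 5 * z ^+ 2) * y ^+ 3 + z ^+ 5 * z ^+ 5 * y ^+ 4)).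
  by rewrite /a /b; ring.
rewrite z5 !mul1r -/b [z ^+ 4 + z]addrC -/a [z ^+ 3 + _]addrC -/b abD.
have -> : (1 - y - y ^+ 2)
   * (1 - a * y + (1 - (- 1 - a)) * y ^+ 2 + a * y ^+ 3 + y ^+ 4)
   * (1 - (- 1 - a) * y + (1 - a) * y ^+ 2 + (- 1 - a) * y ^+ 3 + y ^+ 4)
   = 1 - 11%:R * y ^+ 5 - y ^+ 10
     + (a ^+ 2 + a - 1) * (y ^+ 8 + 3%:R * y ^+ 7 - 5%:R * y ^+ 5 + 3%:R * y ^+ 3 - y ^+ 2).
  by ring.
by rewrite aE mul0r addr0.
Qed.
End Norm.

Section Twist.
Variables (R : comNzRingType) (c : R).

(* The substitution q -> c q. *)
Definition twist (f : fps R) : fps R := FPS (fun n => c ^+ n * fpscoef f n).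

Lemma twist_is_zmod : zmod_morphism twist.
Proof. by move=> f g; apply: fpsP => n; rewrite /= mulrBr. Qed.

Lemma twist_is_monoid : monoid_morphism twist.
Proof.
split; first by apply: fpsP => -[|n]; rewrite /= ?mul1r ?mulr0.
move=> f g; apply: fpsP => n; rewrite [LHS]/= fpscoefM mulr_sumr; apply: eq_bigr => i _ /=.
by rewrite mulrACA -exprD subnKC // -ltnS.
Qed.

HB.instance Definition _ := GRing.isZmodMorphism.Build (fps R) (fps R) twist twist_is_zmod.
HB.instance Definition _ := GRing.isMonoidMorphism.Build (fps R) (fps R) twist twist_is_monoid.

Lemma twistX : twist (fpsX R) = fpsC c * fpsX R.
Proof.
by apply: fpsP => n; rewrite fpscoefCM /=; case: eqP => [->|]; rewrite ?mulr0 // expr1.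
Qed.

Lemma twist_dilate f : c ^+ 5 = 1 -> twist (V f) = V f.
Proof.
move=> c5; apply: fpsP => n /=; case: ifP => [/dvdnP[m ->]|]; last by rewrite mulr0.
by rewrite mulnC exprM c5 expr1n mul1r.
Qed.

Lemma fps_eqmod_twist N f g : fps_eqmod N f g -> fps_eqmod N (twist f) (twist g).
Proof. by move=> fg n nN /=; rewrite fg. Qed.

End Twist.

Section FpsMap.
Variables (R S : comNzRingType) (phi : {rmorphism R -> S}).

Definition fps_map (f : fps R) : fps S := FPS (fun n => phi (fpscoef f n)).

Lemma fps_map_is_zmod : zmod_morphism fps_map.
Proof. by move=> f g; apply: fpsP => n; rewrite /= rmorphB. Qed.

Lemma fps_map_is_monoid : monoid_morphism fps_map.
Proof.
split; first by apply: fpsP => n; rewrite /= rmorph_nat.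
move=> f g; apply: fpsP => n; rewrite [LHS]/= fpscoefM rmorph_sum; apply: eq_bigr => i _ /=.
by rewrite rmorphM.
Qed.

HB.instance Definition _ := GRing.isZmodMorphism.Build (fps R) (fps S) fps_map fps_map_is_zmod.
HB.instance Definition _ := GRing.isMonoidMorphism.Build (fps R) (fps S) fps_map fps_map_is_monoid.

Lemma fps_mapX : fps_map (fpsX R) = fpsX S.
Proof. by apply: fpsP => n; rewrite /= rmorph_nat. Qed.

Lemma fps_map_dilate d f : fps_map (dilate d f) = dilate d (fps_map f).
Proof. by apply: fpsP => n /=; case: ifP; rewrite ?rmorph0. Qed.

Lemma fps_eqmod_map N f g : fps_eqmod N f g -> fps_eqmod N (fps_map f) (fps_map g).
Proof. by move=> fg n nN /=; rewrite fg. Qed.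

End FpsMap.

(** Identities that involve a fifth root of unity are proved over [algC] and brought back to [rat]
    by this injectivity. *)
Lemma fps_map_inj (F : fieldType) (S : comNzRingType) (phi : {rmorphism F -> S}) :
  injective (fps_map phi).
Proof.
move=> f g /(congr1 (fun h => fpscoef h _)) fg; apply: fpsP => n.
exact/(fmorph_inj phi)/fg.
Qed.

Section FpsC.
Variable R : comNzRingType.

Lemma fpsC_is_zmod : zmod_morphism (@fpsC R).
Proof. by move=> a b; apply: fpsP => n /=; case: eqP; rewrite ?subr0. Qed.

Lemma fpsC_is_monoid : monoid_morphism (@fpsC R).
Proof. by split; [apply: fpsC1 | apply: fpsCM]. Qed.

HB.instance Definition _ := GRing.isZmodMorphism.Build R (fps R) (@fpsC R) fpsC_is_zmod.
HB.instance Definition _ := GRing.isMonoidMorphism.Build R (fps R) (@fpsC R) fpsC_is_monoid.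
End FpsC.

Section EulerNorm.
Variable z : algC.
Hypothesis z5 : 5.-primitive_root z.

Let X := fpsX algC.
Local Notation mapC := (fps_map (@ratr algC)).
Let N (f : fps algC) := \prod_(0 <= i < 5) twist (z ^+ i) f.

Let NM f g : N (f * g) = N f * N g.
Proof. by rewrite /N -big_split; apply: eq_bigr => i _; rewrite rmorphM. Qed.

Lemma prim5_sum k : ~~ (5 %| k)%N ->
  1 + z ^+ k + (z ^+ k) ^+ 2 + (z ^+ k) ^+ 3 + (z ^+ k) ^+ 4 = 0.
Proof.
move=> k5; have zk1 : z ^+ k - 1 != 0 by rewrite subr_eq0 -(prim_order_dvd z5).
apply: (mulfI zk1); rewrite mulr0; transitivity ((z ^+ k) ^+ 5 - 1); first by ring.
by rewrite -exprM mulnC exprM (prim_expr_order z5) expr1n subrr.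
Qed.

Let N_factor k : N (1 - X ^+ k) = if (5 %| k)%N then (1 - X ^+ k) ^+ 5 else 1 - X ^+ (5 * k).
Proof.
have tX i : twist (z ^+ i) (1 - X ^+ k) = 1 - fpsC (z ^+ k) ^+ i * X ^+ k.
  by rewrite rmorphB rmorph1 rmorphXn /= twistX exprMn -!rmorphXn /= -!exprM mulnC.
rewrite /N (eq_bigr _ (fun i _ => tX i)); case: ifP => [k5|/negbT k5].
  have -> : z ^+ k = 1 by apply/eqP; rewrite -(prim_order_dvd z5).
  by rewrite fpsC1 !big_nat_recr //= big_geq // mul1r !expr1n !mul1r; ring.
rewrite norm5_1sub ?[(5 * k)%N]mulnC ?exprM //.
by have := congr1 (@fpsC algC) (prim5_sum k5); rewrite !rmorphD !(rmorphXn (@fpsC algC)) rmorph1 rmorph0.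
Qed.

Let map_euler_partial r M : mapC (euler_partial r M) = \prod_(1 <= k < M.+1) (1 - X ^+ (r * k)).
Proof.
rewrite rmorph_prod; apply: eq_bigr => i _.
by rewrite rmorphB rmorph1 rmorphXn /= qE fps_mapX.
Qed.

Let ep r M : fps algC := \prod_(1 <= k < M.+1) (1 - X ^+ (r * k)).

Let epS r M : ep r M.+1 = ep r M * (1 - X ^+ (r * M.+1)).
Proof. exact: big_nat_recr. Qed.

Let N_ep M : N (ep 1 (5 * M)) * ep 25 M = ep 5 (5 * M) * ep 5 M ^+ 5.
Proof.
elim: M => [|M IHM].
  by rewrite muln0 /ep !big_geq // expr1n !mulr1 /N big1 // => i _; exact: rmorph1.
have -> : (5 * M.+1 = (5 * M).+4.+1)%N by lia.
rewrite !epS !NM !mul1n !N_factor.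
have -> : (5 %| (5 * M).+1 = false)%N by lia.
have -> : (5 %| (5 * M).+2 = false)%N by lia.
have -> : (5 %| (5 * M).+3 = false)%N by lia.
have -> : (5 %| (5 * M).+4 = false)%N by lia.
have -> : (5 %| (5 * M).+4.+1 = true)%N by lia.
have -> : ((5 * M).+4.+1 = 5 * M.+1)%N by lia.
rewrite (_ : 25 * M.+1 = 5 * (5 * M.+1))%N; last by lia.
rewrite exprMn; move: IHM; move: (N _) (ep 5 _) (ep 5 _) (ep 25 _) => n e5' e5 e25 IH.
move: (X ^+ _) (X ^+ _) (X ^+ _) (X ^+ _) (X ^+ _) (X ^+ _) => x1 x2 x3 x4 x5 x6.
have -> : forall g1 g2 g3 g4 g5 g6, e5 * g1 * g2 * g3 * g4 * g5 * (e5' ^+ 5 * g6)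
  = e5 * e5' ^+ 5 * (g1 * g2 * g3 * g4 * g5 * g6) by move=> *; ring.
by rewrite -IH; ring.
Qed.

(** By [N_factor] the factors of index prime to 5 contribute [f_5 / f_25], and the others
    [f_5^5]. *)
Lemma euler_norm : N (mapC (euler 1)) * mapC (euler 25) = mapC (euler 5) ^+ 6.
Proof.
apply: fps_eqmodP => M.
have eu r m : (0 < r)%N -> (M <= m)%N -> fps_eqmod M (mapC (euler r)) (ep r m).
  by move=> *; rewrite /ep -map_euler_partial; apply/fps_eqmod_map/euler_eqmod.
apply: (fps_eqmod_trans (g := N (ep 1 (5 * M)) * ep 25 M)).
  apply: fps_eqmodM; last exact: eu.
  have: fps_eqmod M (mapC (euler 1)) (ep 1 (5 * M)) by apply: eu => //; lia.
  rewrite /N; move: (mapC _) (ep _ _) => f g fg.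
  elim: (5%N) => [|n IHn]; first by rewrite !big_geq.
  by rewrite !big_nat_recr //; apply: fps_eqmodM => //; apply: fps_eqmod_twist.
rewrite N_ep [X in fps_eqmod _ _ X]exprS; apply: fps_eqmodM; first by apply/fps_eqmod_sym/eu; lia.
by apply/fps_eqmod_expr/fps_eqmod_sym/eu.
Qed.

End EulerNorm.

(** * The Rogers-Ramanujan continued fraction *)

Section IntegralDomain.
Variable R : idomainType.
Implicit Types f g : fps R.

Lemma fps_valuation f : f != 0 ->
  exists2 n, fpscoef f n != 0 & fps_eqmod n f 0.
Proof.
move=> f0; have [n fn] : exists n, fpscoef f n != 0.
  apply: boolp.contrapT => fn; case/eqP: f0; apply: fpsP => n.
  by apply/eqP/negPn/negP => ?; apply: fn; exists n.
have fE : exists n, (fun n => fpscoef f n != 0) n by exists n.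
have [m fm min_m] := ex_minnP fE.
exists m => // i im; apply/eqP; apply: contraTT im => fi; rewrite -leqNgt; exact: min_m.
Qed.

Lemma fps_mulf_eq0 f g : f * g = 0 -> (f == 0) || (g == 0).
Proof.
move=> fg0; apply/norP => -[/fps_valuation[n fn f0] /fps_valuation[m gm g0]].
have : fpscoef (f * g) (n + m) = fpscoef f n * fpscoef g m.
  have nm : (n < (n + m).+1)%N by rewrite ltnS leq_addr.
  rewrite fpscoefM (bigD1 (Ordinal nm)) //= addKn big1 ?addr0 // => i.
  rewrite -val_eqE /= => ni; have [i_n|n_i] := ltnP i n; first by rewrite f0 ?mul0r.
  by rewrite g0 ?mulr0 //; have := ltn_ord i; lia.
by rewrite fg0 => /esym/eqP; rewrite mulf_eq0 (negbTE fn) (negbTE gm).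
Qed.

HB.instance Definition _ :=
  GRing.ComUnitRing_isIntegral.Build (fps R) fps_mulf_eq0.
End IntegralDomain.

Lemma fps_coef0_unit (R : comUnitRingType) (f : fps R) : fpscoef f 0 = 1 -> f \is a GRing.unit.
Proof. by move=> f0; rewrite unfold_in /= /fps_unit f0 unitr1. Qed.

Lemma fpscoef0M (R : comNzRingType) (f g : fps R) :
  fpscoef (f * g) 0 = fpscoef f 0 * fpscoef g 0.
Proof. by rewrite fpscoefM big_ord1. Qed.

Lemma euler_coef0 r : fpscoef (euler r) 0 = 1.
Proof. by rewrite /= euler_partial0. Qed.

Lemma pent0_coef0 : fpscoef pent0 0 = 1. Proof. exact: euler_coef0. Qed.

Lemma pent0_unit : pent0 \is a GRing.unit.
Proof. exact/fps_coef0_unit/pent0_coef0. Qed.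

(* rr is q^(-1/5) times the Rogers-Ramanujan continued fraction, ss = rr(q^2), and
   kk is Ramanujan's parameter, a generator of the function field of X_1(10). *)
Definition rr : qseries := euler 5 / pent0.
Definition ss : qseries := W rr.
Definition kk : qseries := q * rr * ss ^+ 2.

Lemma rr_unit : rr \is a GRing.unit.
Proof. by rewrite unitrM euler_unit unitrV pent0_unit. Qed.

Lemma dilate_unit d (f : qseries) : f \is a GRing.unit -> dilate d.+1 f \is a GRing.unit.
Proof. exact: rmorph_unit. Qed.

Lemma ss_unit : ss \is a GRing.unit.
Proof. exact/dilate_unit/rr_unit. Qed.

Lemma pent0_rr : pent0 * rr = euler 5.
Proof. by rewrite mulrC divrK // pent0_unit. Qed.

Lemma Wpent0_ss : W pent0 * ss = euler 10.
Proof. by rewrite -rmorphM pent0_rr /= dilate_euler. Qed.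

Lemma dilate25C (f : qseries) : W (V f) = V (W f).
Proof. by rewrite !dilate_dilate. Qed.

Lemma psi_euler1 : gauss_psi * euler 1 = euler 2 ^+ 2.
Proof. by rewrite divrK // euler_unit. Qed.

Lemma euler2_dissection :
  euler 2 = V (W pent0) - q ^+ 2 * V (euler 10) + q ^+ 4 * V (W pent2).
Proof.
rewrite -(@dilate_euler 1 1) // euler1_dissection rmorphD rmorphB /=.
rewrite (rmorphM _ q) (rmorphM _ (q ^+ 2)) rmorphXn /=.
by rewrite qE dilateX !dilate25C !dilate_euler -?exprM.
Qed.

(** The five sections of [f_2^2 = psi f_1], in the order of the residues 0 to 4. *)
Lemma dissected_psi_euler1 :
  [/\ W pent0 ^+ 2 = psi0 * pent0 + q * V gauss_psi * pent2,
      - (2%:R * q * euler 10 * W pent2) = psi1 * pent0 - psi0 * euler 5,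
      - (2%:R * W pent0 * euler 10) = psi0 * pent2 - psi1 * euler 5,
      q * W pent2 ^+ 2 = V gauss_psi * pent0 + psi1 * pent2 &
      euler 10 ^+ 2 + 2%:R * (W pent0 * W pent2) = - (V gauss_psi * euler 5)].
Proof.
set g0 := W pent0; set g2 := W pent2; set p := V gauss_psi.
have Vq : V q = q ^+ 5 by rewrite qE dilateX.
have H r : (r < 5)%N ->
  [:: g0 ^+ 2; - (2%:R * q * euler 10 * g2); - (2%:R * g0 * euler 10); q * g2 ^+ 2;
      euler 10 ^+ 2 + 2%:R * (g0 * g2)]`_r =
  [:: psi0 * pent0 + q * p * pent2; psi1 * pent0 - psi0 * euler 5;
      psi0 * pent2 - psi1 * euler 5; p * pent0 + psi1 * pent2; - (p * euler 5)]`_r.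
  move=> r5; rewrite -!(section_combination _ _ _ _ _ r5); congr (sec r _).
  transitivity (euler 2 ^+ 2).
    rewrite euler2_dissection -/g0 -/g2 !(rmorphD, rmorphN, rmorphM, rmorphXn, rmorph_nat) /= Vq.
    by ring.
  rewrite -psi_euler1 [in LHS]gauss_psi_sections [in LHS]euler1_dissection -/p.
  by rewrite !(rmorphD, rmorphN, rmorphM, rmorphXn, rmorph_nat) /= Vq; ring.
by split; [exact: (H 0%N)|exact: (H 1%N)|exact: (H 2%N)|exact: (H 3%N)|exact: (H 4%N)].
Qed.

Lemma Vpsi_euler5 : V gauss_psi * euler 5 = euler 10 ^+ 2.
Proof.
rewrite -[euler 5](@dilate_euler 4 1) // -rmorphM psi_euler1 rmorphXn /=.
by rewrite dilate_euler.
Qed.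

Lemma pent2_rr : pent2 = - (pent0 * rr ^+ 2).
Proof.
have [_ _ _ _ E] := dissected_psi_euler1.
have E2 : W pent0 * W pent2 = - W (euler 5 ^+ 2).
  rewrite Vpsi_euler5 in E.
  have two : (2%:R : qseries) \is a GRing.unit.
    change (fpscoef (2%:R : qseries) 0%N \is a GRing.unit).
    by rewrite (_ : fpscoef _ _ = 2%:R) // unitfE.
  apply: (mulrI two); rewrite rmorphXn /= dilate_euler //=.
  by rewrite -[LHS](addKr (euler 10 ^+ 2)) E; ring.
have {}E2 : pent0 * pent2 = - euler 5 ^+ 2.
  by apply: (@dilate_inj rat 1); rewrite rmorphM rmorphN /=.
by apply: (mulrI pent0_unit); rewrite E2 -pent0_rr; ring.
Qed.

Lemma Wpent2_ss : W pent2 = - (W pent0 * ss ^+ 2).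
Proof. by rewrite pent2_rr rmorphN rmorphM rmorphXn. Qed.

Lemma Wpent0_unit : W pent0 \is a GRing.unit.
Proof. exact/dilate_unit/pent0_unit. Qed.

Lemma Vpsi_pent0 : V gauss_psi * pent0 * rr = (W pent0 * ss) ^+ 2.
Proof. by rewrite -mulrA pent0_rr Vpsi_euler5 Wpent0_ss. Qed.

Lemma psi0_pent0 : psi0 * pent0 = W pent0 ^+ 2 * (1 + kk).
Proof.
have [E _ _ _ _] := dissected_psi_euler1; have Ep := Vpsi_pent0; rewrite pent2_rr in E.
transitivity (W pent0 ^+ 2 + q * rr * (V gauss_psi * pent0 * rr)); first by rewrite E; ring.
by rewrite Ep /kk; ring.
Qed.

Lemma psi1_pent0 : psi1 * pent0 * rr ^+ 3 = W pent0 ^+ 2 * ss ^+ 2 * (1 - kk).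
Proof.
have [_ _ _ E _] := dissected_psi_euler1; have Ep := Vpsi_pent0.
rewrite Wpent2_ss pent2_rr in E.
have -> : psi1 * pent0 * rr ^+ 3
    = V gauss_psi * pent0 * rr - rr * (q * (- (W pent0 * ss ^+ 2)) ^+ 2) by rewrite E; ring.
by rewrite Ep /kk; ring.
Qed.

Lemma rr_ss_square : (ss - rr ^+ 2) ^+ 2 = kk * (ss ^+ 2 - rr ^+ 4).
Proof.
have [_ _ E _ _] := dissected_psi_euler1; have E0 := psi0_pent0; have E1 := psi1_pent0.
have g2U : W pent0 ^+ 2 \is a GRing.unit by rewrite unitrX ?Wpent0_unit.
apply: (mulrI g2U).
have : 2%:R * W pent0 ^+ 2 * ss * rr ^+ 2 = psi0 * pent0 * rr ^+ 4 + psi1 * pent0 * rr ^+ 3.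
  transitivity (- (- (2%:R * W pent0 * euler 10)) * rr ^+ 2); first by rewrite -Wpent0_ss; ring.
  by rewrite E pent2_rr -pent0_rr; ring.
rewrite E0 E1 => H.
rewrite (_ : W pent0 ^+ 2 * (ss - rr ^+ 2) ^+ 2
  = W pent0 ^+ 2 * (ss ^+ 2 + rr ^+ 4) - 2%:R * W pent0 ^+ 2 * ss * rr ^+ 2); last by ring.
by rewrite H; ring.
Qed.

Lemma q_neq0 : q != 0.
Proof. by apply/eqP => /(congr1 (fun f => fpscoef f 1)) /eqP; rewrite /= oner_eq0. Qed.

Lemma nat_neq0 n : (n.+1%:R : qseries) != 0.
Proof.
apply/eqP => /(congr1 (fun f => fpscoef f 0)) /eqP.
have -> : fpscoef (n.+1%:R : qseries) 0 = n.+1%:R.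
  by elim: n => // n IHn; rewrite mulrS fpscoefD IHn [in RHS]mulrS.
by rewrite pnatr_eq0.
Qed.

(** The constant term of the difference is 0, so it decides nothing; by section 1 an equality would
    force [4 q rr^9 = 0]. *)
Lemma ss_neq_rr2 : ss - rr ^+ 2 != 0.
Proof.
have [_ E _ _ _] := dissected_psi_euler1; have E0 := psi0_pent0; have E1 := psi1_pent0.
rewrite subr_eq0; apply/eqP => sr.
have g2U : W pent0 ^+ 2 \is a GRing.unit by rewrite unitrX ?Wpent0_unit.
have : W pent0 ^+ 2 * (2%:R * q * ss ^+ 3 * rr ^+ 3)
  = W pent0 ^+ 2 * (ss ^+ 2 * (1 - kk) - rr ^+ 4 * (1 + kk)).
  transitivity (psi1 * pent0 * rr ^+ 3 - psi0 * pent0 * rr ^+ 4); last by rewrite E0 E1; ring.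
  transitivity ((- (2%:R * q * euler 10 * W pent2)) * rr ^+ 3).
    by rewrite Wpent2_ss -Wpent0_ss; ring.
  by rewrite E -pent0_rr; ring.
move/(mulrI g2U) => H.
have : 4%:R * q * rr ^+ 9 = 0.
  transitivity (2%:R * q * ss ^+ 3 * rr ^+ 3 + 2%:R * q * rr ^+ 9); first by rewrite sr; ring.
  by rewrite H /kk sr; ring.
move/(canRL (mulrK (unitrX 9 rr_unit))); rewrite mul0r => /eqP.
by rewrite mulf_eq0 (negbTE q_neq0) (negbTE (nat_neq0 3)).
Qed.

(** Ramanujan's relation [(b - a^2) / (b + a^2) = a b^2] between the continued fractions
    [a = q^(1/5) rr] at [q] and [b = q^(2/5) ss] at [q^2]. *)
Lemma rr_ss : ss * (1 - kk) = rr ^+ 2 * (1 + kk).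
Proof.
have H := rr_ss_square.
suff : ss - rr ^+ 2 = kk * (ss + rr ^+ 2).
  by move/eqP; rewrite subr_eq => /eqP H1; rewrite mulrBr mulr1 {1}H1; ring.
by apply: (mulfI ss_neq_rr2); rewrite -expr2 H; ring.
Qed.

Lemma theta_relation :
  euler 2 * euler 5 ^+ 5 * rr * ss ^+ 2 = euler 1 * euler 10 ^+ 5 * (1 - kk ^+ 2).
Proof.
have E : psi0 * psi1 * euler 5 ^+ 2 * rr * ss ^+ 2 = euler 10 ^+ 4 * (1 - kk ^+ 2).
  transitivity (psi0 * pent0 * (psi1 * pent0 * rr ^+ 3) * ss ^+ 2).
    by rewrite -pent0_rr; ring.
  by rewrite psi0_pent0 psi1_pent0 -Wpent0_ss; ring.
transitivity (psi0 * psi1 * (euler 1 * euler 10) * (euler 5 ^+ 2 * rr * ss ^+ 2)).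
  by rewrite psi0_psi1; ring.
transitivity (euler 1 * euler 10 * (psi0 * psi1 * euler 5 ^+ 2 * rr * ss ^+ 2)); first by ring.
by rewrite E; ring.
Qed.

Definition uu : qseries := q * V rr.
Definition vv : qseries := q ^+ 2 * V ss.

Lemma euler1_uu : euler 1 = V pent0 * (1 - uu - uu ^+ 2).
Proof.
rewrite {1}euler1_dissection pent2_rr -pent0_rr rmorphN.
by rewrite !(rmorphM _ pent0) rmorphXn /= /uu; ring.
Qed.

Lemma euler2_vv : euler 2 = V (W pent0) * (1 - vv - vv ^+ 2).
Proof.
rewrite {1}euler2_dissection Wpent2_ss -Wpent0_ss rmorphN.
by rewrite !(rmorphM _ (W pent0)) rmorphXn /= /vv; ring.
Qed.

(** The norm of [euler1_uu] under [q -> z q], which fixes the image of [V] and multiplies [uu] by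
    [z], is compared with [euler_norm], and [V] is undone. For [R^5 = q rr^5] this is Ramanujan's
    [1 / R^5 - 11 - R^5 = f_1^6 / (q f_5^6)]. *)
Lemma euler_quintic :
  euler 1 ^+ 6 * rr ^+ 5
  = euler 5 ^+ 6 * (1 - 11%:R * (q * rr ^+ 5) - (q * rr ^+ 5) ^+ 2).
Proof.
have [z z5] := C_prim_root_exists (isT : 0 < 5)%N.
have z51 := prim_expr_order z5.
have norm := euler_norm z5.
have twE i : twist (z ^+ i) (fps_map (@ratr algC) (euler 1))
    = V (fps_map (@ratr algC) pent0)
      * (1 - fpsC z ^+ i * fps_map (@ratr algC) uu
           - (fpsC z ^+ i * fps_map (@ratr algC) uu) ^+ 2).
  have zi5 : (z ^+ i) ^+ 5 = 1 by rewrite -exprM mulnC exprM z51 expr1n.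
  have tu : twist (z ^+ i) (fps_map (@ratr algC) uu) = fpsC z ^+ i * fps_map (@ratr algC) uu.
    rewrite /uu (rmorphM _ q) /= (rmorphM _ (fps_map _ q)) /= fps_map_dilate twist_dilate //.
    by rewrite qE fps_mapX twistX rmorphXn mulrA.
  rewrite {1}euler1_uu (rmorphM _ (V pent0)) /= (rmorphM _ (fps_map _ (V pent0))) /= fps_map_dilate twist_dilate //; congr (_ * _).
  by rewrite !(rmorphB, rmorph1, rmorphXn) /= tu.
have zs : 1 + fpsC z + fpsC z ^+ 2 + fpsC z ^+ 3 + fpsC z ^+ 4 = 0.
  have := congr1 (@fpsC algC) (prim5_sum z5 (isT : ~~ (5 %| 1)%N)).
  by rewrite expr1 !rmorphD !(rmorphXn (@fpsC algC)) rmorph1 rmorph0.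
have {}norm : euler 5 ^+ 6
    = V pent0 ^+ 5 * (1 - 11%:R * uu ^+ 5 - uu ^+ 10) * euler 25.
  apply: (@fps_map_inj _ _ (@ratr algC)).
  rewrite rmorphXn /= -norm [RHS]rmorphM; congr (_ * _).
  rewrite (eq_bigr _ (fun i _ => twE i)) big_split /= norm5_quadratic // prodr_const_nat.
  rewrite [RHS]rmorphM rmorphXn /= fps_map_dilate; congr (_ * _).
  by rewrite rmorphB [in RHS]rmorphB rmorph1 (rmorphM _ 11%:R) !rmorphXn rmorph_nat.
have uu5 : uu ^+ 5 = V (q * rr ^+ 5).
  by rewrite (rmorphM _ q) rmorphXn /= qE dilateX exprMn.
have {}norm : euler 1 ^+ 6
    = pent0 ^+ 5 * (1 - 11%:R * (q * rr ^+ 5) - (q * rr ^+ 5) ^+ 2) * euler 5.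
  apply: (@dilate_inj rat 4).
  rewrite rmorphXn [RHS]rmorphM /= !dilate_euler // norm; congr (_ * _).
  rewrite [RHS]rmorphM rmorphXn /=; congr (_ * _).
  move: uu5; move: (q * rr ^+ 5) => w uu5.
  by rewrite !rmorphB rmorph1 (rmorphM _ 11%:R) rmorphXn rmorph_nat /= -uu5 -exprM.
by rewrite norm -pent0_rr; ring.
Qed.

(** * Ramanujan's parameter *)

Lemma kk_coef0 : fpscoef kk 0 = 0.
Proof. by rewrite /kk -mulrA fpscoef0M mul0r. Qed.

Definition PP : qseries := 1 - 4%:R * kk - kk ^+ 2.
Definition QQ : qseries := 1 + kk - kk ^+ 2.

Lemma coef0_1kk (f : qseries) : fpscoef (1 + f * kk) 0 = 1.
Proof. by rewrite fpscoefD fpscoef1 fpscoef0M kk_coef0 mulr0 addr0. Qed.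

Lemma fps_unit_1kk (f : qseries) : 1 + f * kk \is a GRing.unit.
Proof. exact/fps_coef0_unit/coef0_1kk. Qed.

Lemma kk1_unit : 1 + kk \is a GRing.unit.
Proof. by have := fps_unit_1kk 1; rewrite mul1r. Qed.

Lemma kkm1_unit : 1 - kk \is a GRing.unit.
Proof. by have := fps_unit_1kk (-1); rewrite mulN1r. Qed.

Lemma PP_unit : PP \is a GRing.unit.
Proof. by have := fps_unit_1kk (- 4%:R - kk); congr (_ \is a _); rewrite /PP; ring. Qed.

Lemma QQ_unit : QQ \is a GRing.unit.
Proof. by have := fps_unit_1kk (1 - kk); congr (_ \is a _); rewrite /QQ; ring. Qed.

Lemma unit_mul (f g : qseries) :
  f \is a GRing.unit -> g \is a GRing.unit -> f * g \is a GRing.unit.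
Proof. by move=> fU gU; rewrite unitrM fU. Qed.

Ltac unit_product := repeat first
  [ exact: euler_unit | exact: rr_unit | exact: ss_unit | exact: kk1_unit | exact: kkm1_unit
  | exact: PP_unit | exact: QQ_unit | exact: pent0_unit | exact: Wpent0_unit
  | apply: dilate_unit | apply: unitrX | apply: unit_mul ].

Lemma rr5E : (1 + kk) ^+ 2 * (q * rr ^+ 5) = kk * (1 - kk) ^+ 2.
Proof.
transitivity (q * rr * (rr ^+ 2 * (1 + kk)) ^+ 2); first by ring.
by rewrite -rr_ss {2}/kk; ring.
Qed.

Lemma ss5E : (1 - kk) * (q ^+ 2 * ss ^+ 5) = kk ^+ 2 * (1 + kk).
Proof.
transitivity (q ^+ 2 * ss ^+ 4 * (ss * (1 - kk))); first by ring.
by rewrite rr_ss {2}/kk; ring.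
Qed.

Lemma euler1_quintic :
  euler 1 ^+ 6 * rr ^+ 5 * (1 + kk) ^+ 4 = euler 5 ^+ 6 * (PP ^+ 2 * QQ).
Proof.
rewrite euler_quintic -mulrA; congr (_ * _).
transitivity ((1 + kk) ^+ 4 - 11%:R * (1 + kk) ^+ 2 * ((1 + kk) ^+ 2 * (q * rr ^+ 5))
  - ((1 + kk) ^+ 2 * (q * rr ^+ 5)) ^+ 2); first by ring.
by rewrite rr5E /PP /QQ; ring.
Qed.

Lemma euler2_quintic :
  euler 2 ^+ 6 * ss ^+ 5 * (1 - kk) ^+ 2 = euler 10 ^+ 6 * (PP * QQ ^+ 2).
Proof.
have -> : euler 2 ^+ 6 * ss ^+ 5
  = euler 10 ^+ 6 * (1 - 11%:R * (q ^+ 2 * ss ^+ 5) - (q ^+ 2 * ss ^+ 5) ^+ 2).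
  have := congr1 (@dilate rat 2) euler_quintic.
  have Ww : W (q * rr ^+ 5) = q ^+ 2 * ss ^+ 5.
    by rewrite (rmorphM _ q) rmorphXn /= qE dilateX.
  move: Ww; move: (q * rr ^+ 5) => w Ww.
  rewrite (rmorphM _ (euler 1 ^+ 6)) (rmorphM _ (euler 5 ^+ 6)) !rmorphB rmorph1.
  rewrite (rmorphM _ 11%:R) rmorph_nat !rmorphXn /= Ww !dilate_euler //.
rewrite -mulrA; congr (_ * _).
transitivity ((1 - kk) ^+ 2 - 11%:R * (1 - kk) * ((1 - kk) * (q ^+ 2 * ss ^+ 5))
  - ((1 - kk) * (q ^+ 2 * ss ^+ 5)) ^+ 2); first by ring.
by rewrite ss5E /PP /QQ; ring.
Qed.

Lemma fps_cube_inj (f g : qseries) : fpscoef f 0 = 1 -> fpscoef g 0 = 1 ->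
  f ^+ 3 = g ^+ 3 -> f = g.
Proof.
move=> f0 g0 fg; apply/eqP; rewrite -subr_eq0.
have : (f - g) * (f ^+ 2 + f * g + g ^+ 2) = 0.
  by transitivity (f ^+ 3 - g ^+ 3); [ring | rewrite fg subrr].
move/eqP; rewrite mulf_eq0 => /orP[//|/eqP /(congr1 (fun h => fpscoef h 0)) /eqP].
by rewrite !fpscoefD !expr2 !fpscoef0M f0 g0.
Qed.

(** Combining [euler2_quintic] with the square of [euler1_quintic] yields the cube of this identity;
    cube roots with constant term 1 are unique. *)
Lemma euler_square_relation :
  euler 2 ^+ 2 * euler 5 ^+ 4 * PP = (1 - kk ^+ 2) * (euler 1 ^+ 4 * euler 10 ^+ 2).
Proof.
have P0 : fpscoef PP 0 = 1.
  by rewrite -[RHS](coef0_1kk (- 4%:R - kk)); congr fpscoef; rewrite /PP; ring.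
have k0 : fpscoef (1 - kk ^+ 2) 0 = 1.
  by rewrite -[RHS](coef0_1kk (- kk)); congr fpscoef; ring.
have e0 r n : fpscoef (euler r ^+ n) 0 = 1.
  by elim: n => // n IHn; rewrite exprS fpscoef0M IHn euler_coef0 mulr1.
apply: fps_cube_inj.
- by rewrite (fpscoef0M _ PP) (fpscoef0M (_ ^+ _)) !e0 P0 !mulr1.
- by rewrite (fpscoef0M (1 - _)) (fpscoef0M (_ ^+ _)) !e0 k0 !mulr1.
have U : ss ^+ 5 * rr ^+ 10 * (1 - kk) ^+ 2 * (1 + kk) ^+ 8 \is a GRing.unit.
  by unit_product.
apply: (mulrI U).
transitivity ((euler 2 ^+ 6 * ss ^+ 5 * (1 - kk) ^+ 2) * euler 5 ^+ 12 * PP ^+ 3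
   * (1 + kk) ^+ 3 * (rr ^+ 2 * (1 + kk)) ^+ 5); first by ring.
rewrite euler2_quintic -rr_ss.
transitivity ((1 - kk ^+ 2) ^+ 3 * euler 10 ^+ 6 * (1 - kk) ^+ 2 * ss ^+ 5
   * (euler 1 ^+ 6 * rr ^+ 5 * (1 + kk) ^+ 4) ^+ 2); last by ring.
by rewrite euler1_quintic; ring.
Qed.

(** Eliminating [1 - kk ^+ 2] between [euler_square_relation] and [theta_relation] leaves exactly
    the eta quotient of [x]. *)
Lemma euler_x_relation :
  euler 2 * euler 10 ^+ 3 * PP = euler 1 ^+ 3 * euler 5 * (rr * ss ^+ 2).
Proof.
have U : euler 2 * euler 5 ^+ 4 * euler 1 \is a GRing.unit.
  by unit_product.
apply: (mulrI U).
transitivity (euler 1 * euler 10 ^+ 3 * (euler 2 ^+ 2 * euler 5 ^+ 4 * PP)); first by ring.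
rewrite euler_square_relation.
transitivity (euler 1 ^+ 4 * (euler 1 * euler 10 ^+ 5 * (1 - kk ^+ 2))); first by ring.
by rewrite -theta_relation; ring.
Qed.

Lemma x_euler : x * (euler 1 ^+ 3 * euler 5) = q * (euler 2 * euler 10 ^+ 3).
Proof.
by rewrite /x -mulrA divrK //; unit_product.
Qed.

Lemma x_kk : x * PP = kk.
Proof.
have U : euler 1 ^+ 3 * euler 5 \is a GRing.unit by unit_product.
apply: (mulrI U); transitivity (x * (euler 1 ^+ 3 * euler 5) * PP); first by ring.
rewrite x_euler; transitivity (q * (euler 2 * euler 10 ^+ 3 * PP)); first by ring.
by rewrite euler_x_relation /kk; ring.
Qed.

Lemma euler_QQ : euler 2 ^+ 3 * euler 10 * (1 - kk ^+ 2) = QQ * (euler 1 * euler 5 ^+ 3).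
Proof.
have U : PP ^+ 2 * ss ^+ 2 * (1 - kk) * (1 + kk) * euler 5 ^+ 4 * euler 10 ^+ 2 \is a GRing.unit.
  by unit_product.
apply: (mulrI U).
transitivity ((euler 2 ^+ 2 * euler 5 ^+ 4 * PP) * (euler 2 * euler 10 ^+ 3 * PP)
   * (ss * (1 - kk)) ^+ 2 * (1 + kk) ^+ 2); first by ring.
rewrite euler_square_relation euler_x_relation rr_ss.
transitivity ((1 - kk ^+ 2) * euler 1 * euler 10 ^+ 2 * euler 5 * ss ^+ 2
   * (euler 1 ^+ 6 * rr ^+ 5 * (1 + kk) ^+ 4)); first by ring.
by rewrite euler1_quintic; ring.
Qed.

(** [f_1] and [f_2] in [x] are replaced by [euler1_uu] and [euler2_vv]; the eta quotient in [q^5]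
    that remains is evaluated by [V] of [euler_QQ]. *)
Lemma x_uu_vv :
  x * (1 - uu - uu ^+ 2) ^+ 3 * vv * V (1 - kk ^+ 2) = V QQ * uu ^+ 3 * (1 - vv - vv ^+ 2).
Proof.
have U : V pent0 ^+ 3 * euler 5 \is a GRing.unit.
  by unit_product.
apply: (mulrI U).
transitivity (q ^+ 2 * V ss * V (1 - kk ^+ 2) * (x * ((V pent0 * (1 - uu - uu ^+ 2)) ^+ 3 * euler 5))).
  by rewrite /vv; ring.
rewrite -euler1_uu x_euler.
have E := congr1 (@dilate rat 5) euler_QQ.
rewrite -Wpent0_ss -pent0_rr in E.
have {}E : V (euler 2) ^+ 3 * (V (W pent0) * V ss) * V (1 - kk ^+ 2)
  = V QQ * (V (euler 1) * (V pent0 * V rr) ^+ 3).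
  move: E; rewrite (rmorphM _ QQ) (rmorphM _ (_ * (_ * ss))) (rmorphM _ (euler 2 ^+ 3)).
  by rewrite (rmorphM _ (euler 1)) (rmorphM _ (W _)) !rmorphXn /= (rmorphM _ pent0).
rewrite !dilate_euler // muln1 in E.
rewrite {1}euler2_vv.
transitivity (q ^+ 3 * (1 - vv - vv ^+ 2)
   * (euler (5 * 2) ^+ 3 * (V (W pent0) * V ss) * V (1 - kk ^+ 2))); first by ring.
by rewrite E /uu; ring.
Qed.

Lemma Phi_uu_vv : Phi * (1 - uu - uu ^+ 2) * (1 - vv - vv ^+ 2) ^+ 2 = V kk.
Proof.
have U : V pent0 * V (W pent0) ^+ 2 \is a GRing.unit.
  by unit_product.
apply: (mulrI U).
transitivity (Phi * (euler 1 * euler 2 ^+ 2)).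
  by rewrite euler1_uu [in RHS]euler2_vv; ring.
rewrite /Phi -mulrA divrK; last by unit_product.
have -> : euler 25 = V pent0 * V rr.
  by rewrite -[LHS](@dilate_euler 4 5) // -pent0_rr (rmorphM _ pent0).
have -> : euler 50 = V (W pent0) * V ss.
  by rewrite -[LHS](@dilate_euler 4 10) // -Wpent0_ss (rmorphM _ (W pent0)).
have -> : V kk = q ^+ 5 * V rr * V ss ^+ 2.
  by rewrite /kk (rmorphM _ (q * rr)) (rmorphM _ q) rmorphXn /= qE dilateX.
by ring.
Qed.

Lemma Phi_coef0 : fpscoef Phi 0 = 0.
Proof. by rewrite /Phi fpscoef0M qE fpscoefXn mul0r. Qed.

Lemma x_coef0 : fpscoef x 0 = 0.
Proof. by rewrite /x fpscoef0M mul0r. Qed.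

Lemma fps_coef0V (f : qseries) : fpscoef f 0 = 1 -> fpscoef f^-1 0 = 1.
Proof.
move=> f0; have /(congr1 (fun g => fpscoef g 0)) := mulVr (fps_coef0_unit f0).
by rewrite fpscoef0M f0 mulr1.
Qed.

Lemma fps_coef0X (f : qseries) n : fpscoef f 0 = 1 -> fpscoef (f ^+ n) 0 = 1.
Proof. by move=> f0; elim: n => // n IHn; rewrite exprS fpscoef0M f0 IHn mulr1. Qed.

Lemma fps_coef0M1 (f g : qseries) :
  fpscoef f 0 = 1 -> fpscoef g 0 = 1 -> fpscoef (f * g) 0 = 1.
Proof. by move=> f0 g0; rewrite fpscoef0M f0 g0 mulr1. Qed.

Lemma x_pow_coef n : fpscoef (x ^+ n) n = 1.
Proof.
set e := euler 2 * euler 10 ^+ 3 / (euler 1 ^+ 3 * euler 5).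
have e0 : fpscoef e 0 = 1.
  apply: fps_coef0M1; first by apply: fps_coef0M1; rewrite ?fps_coef0X ?euler_coef0.
  by apply/fps_coef0V/fps_coef0M1; rewrite ?fps_coef0X ?euler_coef0.
rewrite (_ : x = q * e) // exprMn qE fpscoefXnM ltnn subnn.
exact: fps_coef0X.
Qed.

(** * Polynomial identities by computation *)

Section ZPoly.
Local Open Scope Z_scope.

(** Coefficient lists of binary integers, lowest degree first, on which the large identities below
    are decided by [vm_compute]. *)
Fixpoint zadd (p r : seq Z) : seq Z :=
  match p, r with
  | [::], _ => r
  | _, [::] => p
  | a :: p', b :: r' => Z.add a b :: zadd p' r'
  end.

Definition zscale (c : Z) : seq Z -> seq Z := map (Z.mul c).

Fixpoint zmul (p r : seq Z) : seq Z :=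
  if p is a :: p' then zadd (zscale a r) (Z0 :: zmul p' r) else [::].

Definition zexp (p : seq Z) (n : nat) : seq Z := iter n (zmul p) [:: 1].

Definition zopp (p : seq Z) : seq Z := zscale (-1) p.

(** The difference is tested for zero, so trailing zeros do not matter. *)
Definition zeq (p r : seq Z) : bool := all (Z.eqb 0) (zadd p (zopp r)).

End ZPoly.

Section ZEval.
Variables (R : comNzRingType) (y : R).

Definition zconst (c : Z) : R := (int_of_Z c)%:~R.

Definition zeval (p : seq Z) : R := foldr (fun c s => zconst c + y * s) 0 p.

Lemma zconst0 : zconst Z0 = 0. Proof. by []. Qed.
Lemma zconst1 : zconst (Zpos xH) = 1. Proof. by []. Qed.
Lemma zconstN1 : zconst (Zneg xH) = - 1. Proof. by []. Qed.

Lemma zconstD a b : zconst (Z.add a b) = zconst a + zconst b.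
Proof. by rewrite /zconst (rmorphD int_of_Z a b) /= intrD. Qed.

Lemma zconstM a b : zconst (Z.mul a b) = zconst a * zconst b.
Proof. by rewrite /zconst (rmorphM int_of_Z a b) /= intrM. Qed.

Lemma zevalD p r : zeval (zadd p r) = zeval p + zeval r.
Proof.
elim: p r => [|a p IHp] [|b r] //=; rewrite ?add0r ?addr0 //.
by rewrite zconstD IHp; ring.
Qed.

Lemma zevalZ c p : zeval (zscale c p) = zconst c * zeval p.
Proof. by elim: p => [|a p IHp] //=; rewrite ?mulr0 // zconstM IHp; ring. Qed.

Lemma zevalM p r : zeval (zmul p r) = zeval p * zeval r.
Proof.
elim: p => [|a p IHp] /=; first by rewrite mul0r.
by rewrite zevalD zevalZ /= IHp /zconst /=; ring.
Qed.

Lemma zevalX p n : zeval (zexp p n) = zeval p ^+ n.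
Proof.
elim: n => [|n IHn]; first by rewrite /zexp /= /zconst /= mulr0 addr0.
by rewrite exprS -IHn -zevalM.
Qed.

Lemma zeq_eval p r : zeq p r -> zeval p = zeval r.
Proof.
move=> pr; apply/eqP; rewrite -subr_eq0; apply/eqP.
have <- : zeval (zadd p (zopp r)) = zeval p - zeval r.
  by rewrite zevalD zevalZ /zconst /=; ring.
move: pr; rewrite /zeq; elim: (zadd _ _) => //= a s IHs /andP[a0 /IHs ->].
by case: a a0 => // _; rewrite mulr0 addr0.
Qed.

End ZEval.

(* Coordinates over Z[k] in the basis 1, (1 + k) u, (1 - k) v, (1 + k) u v,
   (1 - k) v^2; thanks to the relations (1 - k) v = (1 + k) u^2 and u v^2 = k
   its structure constants are polynomials in k. *)
Record zvec := Zvec {zv0 : seq Z; zv1 : seq Z; zv2 : seq Z; zv3 : seq Z; zv4 : seq Z}.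

Section ZVec.
Local Open Scope Z_scope.

Definition zsum : seq (seq Z) -> seq Z := foldr zadd [::].

Definition vmul (a b : zvec) : zvec :=
  let: Zvec a0 a1 a2 a3 a4 := a in
  let: Zvec b0 b1 b2 b3 b4 := b in
  Zvec
   (zadd (zmul a0 b0) (zmul [:: 0; 1; 0; -1]
      (zsum [:: zmul a1 b4; zmul a4 b1; zmul a2 b3; zmul a3 b2])))
   (zsum [:: zmul a0 b1; zmul a1 b0;
      zmul [:: 0; 1; -1] (zadd (zmul a2 b4) (zmul a4 b2)); zmul [:: 0; 1; 1] (zmul a3 b3)])
   (zsum [:: zmul a0 b2; zmul a2 b0; zmul [:: 1; 1] (zmul a1 b1);
      zmul [:: 0; 1; 1] (zadd (zmul a3 b4) (zmul a4 b3))])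
   (zsum [:: zmul a0 b3; zmul a3 b0; zmul [:: 1; -1] (zadd (zmul a1 b2) (zmul a2 b1));
      zmul [:: 0; 1; -1] (zmul a4 b4)])
   (zsum [:: zmul a0 b4; zmul a4 b0; zmul [:: 1; 1] (zadd (zmul a1 b3) (zmul a3 b1));
      zmul [:: 1; -1] (zmul a2 b2)]).

Definition vadd (a b : zvec) : zvec :=
  let: Zvec a0 a1 a2 a3 a4 := a in
  let: Zvec b0 b1 b2 b3 b4 := b in
  Zvec (zadd a0 b0) (zadd a1 b1) (zadd a2 b2) (zadd a3 b3) (zadd a4 b4).

Definition vconst (p : seq Z) : zvec := Zvec p [::] [::] [::] [::].

Definition vexp (a : zvec) (n : nat) : zvec := iter n (vmul a) (vconst [:: 1]).

Definition veq (a b : zvec) : bool :=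
  let: Zvec a0 a1 a2 a3 a4 := a in
  let: Zvec b0 b1 b2 b3 b4 := b in
  [&& zeq a0 b0, zeq a1 b1, zeq a2 b2, zeq a3 b3 & zeq a4 b4].

Definition zP : seq Z := [:: 1; -4; -1].
Definition zQ : seq Z := [:: 1; 1; -1].

(* p(x) P^d as a polynomial in k, where x = k / P. *)
Fixpoint zhom (p : seq Z) (d : nat) : seq Z :=
  if p is c :: p' then zadd (zscale c (zexp zP d)) (0 :: zhom p' d.-1) else [::].

(** Row [j] is [A_j]. This table and the next two are certificates, checked by [modularP], [U5_xP]
    and [U5_Phi_xP]. *)
Definition modular_coef : seq (seq Z) := [::
  [:: 0; 1; 20; 150; 500; 625];
  [:: 0; 15; 305; 2325; 7875; 10000];
  [:: 0; 85; 1750; 13525; 46500; 60000];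
  [:: 0; 215; 4475; 35000; 122000; 160000];
  [:: 0; 205; 4300; 34000; 120000; 160000]].

Definition U5_x_coef : seq (seq Z) := [::
  [:: 1];
  [:: 0; 41; 860; 6800; 24000; 32000];
  [:: 0; 86; 10195; 366600; 6534800; 68384000; 450720000; 1907200000; 5056000000; 7680000000;
     5120000000];
  [:: 0; 51; 27495; 2836265; 128688900; 3343692000; 56283680000; 656205600000; 5502096000000;
     33821312000000; 153192960000000; 506956800000000; 1195008000000000; 1904640000000000;
     1843200000000000; 819200000000000];
  [:: 0; 12; 32674; 8579260; 831492275; 42958434000; 1396773180000; 31314949600000;
     511802288800000; 6319880448000000; 60349364480000000; 452174745600000000; 2679038592000000000;
     12574269440000000000; 46561935360000000000; 134544588800000000000; 297365504000000000000;
     485949440000000000000; 553779200000000000000; 393216000000000000000; 131072000000000000000]].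

Definition U5_Phi_x_coef : seq (seq Z) := [::
  [:: 0; 1; 40; 794; 9125; 64475; 286000; 780000; 1200000; 800000];
  [:: 0; 0; 121; 9484; 321025; 6327850; 81874125; 738217500; 4780850000; 22488800000; 76460000000;
     183600000000; 296000000000; 288000000000; 128000000000];
  [:: 0; 0; 140; 35245; 2808365; 117376000; 3100037500; 56831205625; 763507050000; 7771895500000;
     61182640000000; 376797500000000; 1823151200000000; 6913681600000000; 20347776000000000;
     45594240000000000; 75238400000000000; 86272000000000000; 61440000000000000; 20480000000000000];
  [:: 0; 0; 64; 59136; 10547620; 850378650; 40530512250; 1298590915000; 30103152240625;
     528858099450000; 7262462532500000; 79624221710000000; 707157357820000000; 5136043622800000000;
     30674128864000000000; 150938497280000000000; 611049315200000000000; 2024736448000000000000;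
     5439398912000000000000; 11668643840000000000000; 19525324800000000000000;
     24567808000000000000000; 21872640000000000000000; 12288000000000000000000;
     3276800000000000000000];
  [:: 0; 0; 13; 54342; 21645560; 3231134475; 261994052875; 13648364390000; 501535624578125;
     13781722427603125; 294509461032250000; 5030953041631500000; 70082663702580000000;
     807847198383100000000; 7788550590672000000000; 63288334721120000000000;
     435690966505600000000000; 2548759030153600000000000; 12682694057728000000000000;
     53629451281920000000000000; 192118376960000000000000000; 579878492672000000000000000;
     1462436904960000000000000000; 3044539924480000000000000000; 5141902131200000000000000000;
     6869368832000000000000000000; 6987448320000000000000000000; 5085593600000000000000000000;
     2359296000000000000000000000; 524288000000000000000000000]].

(* Coordinates of x P^5 and of Phi P^4 Q^5, the powers of P = 1 - 4 k - k^2 and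
   Q = 1 + k - k^2 clearing the denominators. *)
Definition x_vec : zvec := Zvec
  [:: 0; 41; 204; 252; -228; -330; 228; 252; -204; 41]
  [:: 1; 64; 252; 52; -30; 8; -268; 196; -19]
  [:: 3; 107; 311; 311; -15; 49; 141; -147; 8]
  [:: 8; 147; 141; -49; -15; -311; 311; -107; 3]
  [:: 19; 196; 268; 8; 30; 52; -252; 64; -1].

Definition Phi_vec : zvec := Zvec
  [:: 0; 1; 8; 114; -131; 151; -321; -558; 1434; 584; -1434; -558; 321; 151; 131; 114; -8; 1]
  [:: 0; 1; 31; -2; 284; -604; -184; 1021; -47; -596; -424; -61; 359; 227; -19; 14]
  [:: 0; 4; 18; 190; -184; -80; 279; -97; -180; -624; -300; 576; 372; 100; 59; -5]
  [:: 0; 5; 59; -100; 372; -576; -300; 624; -180; 97; 279; 80; -184; -190; 18; -4]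
  [:: 0; 14; 19; 227; -359; -61; 424; -596; 47; 1021; 184; -604; -284; -2; -31; 1].

(* (1 + k) (1 - u - u^2) and (1 - k) (1 - v - v^2) *)
Definition a_vec : zvec := Zvec [:: 1; 1] [:: -1] [:: -1] [::] [::].
Definition b_vec : zvec := Zvec [:: 1; -1] [::] [:: -1] [::] [:: -1].
Definition e1_vec : zvec := Zvec [::] [:: 1] [::] [::] [::].
Definition e2_vec : zvec := Zvec [::] [::] [:: 1] [::] [::].

End ZVec.

Arguments zadd : simpl never.
Arguments zmul : simpl never.

Section VecEval.
Variables (R : comNzRingType) (k u v : R).
Hypothesis uvE : (1 - k) * v = (1 + k) * u ^+ 2.
Hypothesis kE : u * v ^+ 2 = k.

Definition veval (a : zvec) : R :=
  zeval k (zv0 a) + zeval k (zv1 a) * ((1 + k) * u) + zeval k (zv2 a) * ((1 - k) * v)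
  + zeval k (zv3 a) * ((1 + k) * (u * v)) + zeval k (zv4 a) * ((1 - k) * v ^+ 2).

Lemma vevalD a b : veval (vadd a b) = veval a + veval b.
Proof. by case: a b => [????? [?????]]; rewrite /veval /= !zevalD; ring. Qed.

Lemma veval_const p : veval (vconst p) = zeval k p.
Proof. by rewrite /veval /= !mul0r !addr0. Qed.

Lemma vevalM a b : veval (vmul a b) = veval a * veval b.
Proof.
set e1 := (1 + k) * u; set e2 := (1 - k) * v; set e3 := (1 + k) * (u * v).
set e4 := (1 - k) * v ^+ 2.
have e11 : e1 * e1 = (1 + k) * e2 by rewrite /e1 /e2 uvE; ring.
have e12 : e1 * e2 = (1 - k) * e3 by rewrite /e1 /e2 /e3; ring.
have e13 : e1 * e3 = (1 + k) * e4.
  by transitivity ((1 + k) * v * ((1 + k) * u ^+ 2));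
    [rewrite /e1 /e3; ring | rewrite -uvE /e4; ring].
have e14 : e1 * e4 = k * (1 - k ^+ 2).
  by transitivity ((1 - k ^+ 2) * (u * v ^+ 2)); [rewrite /e1 /e4; ring|rewrite kE; ring].
have e22 : e2 * e2 = (1 - k) * e4 by rewrite /e2 /e4; ring.
have e23 : e2 * e3 = k * (1 - k ^+ 2).
  by transitivity ((1 - k ^+ 2) * (u * v ^+ 2)); [rewrite /e2 /e3; ring|rewrite kE; ring].
have e24 : e2 * e4 = k * (1 - k) * e1.
  transitivity ((1 - k) * v ^+ 2 * ((1 - k) * v)); first by rewrite /e2 /e4; ring.
  by rewrite uvE; transitivity ((1 - k) * (1 + k) * u * (u * v ^+ 2));
    [ring | rewrite kE /e1; ring].
have e33 : e3 * e3 = k * (1 + k) * e1.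
  by transitivity ((1 + k) ^+ 2 * u * (u * v ^+ 2)); [rewrite /e3; ring | rewrite kE /e1; ring].
have e34 : e3 * e4 = k * (1 + k) * e2.
  transitivity ((1 + k) * (1 - k) * v * (u * v ^+ 2)); first by rewrite /e3 /e4; ring.
  by rewrite kE /e2; ring.
have e44 : e4 * e4 = k * (1 - k) * e3.
  transitivity ((1 - k) * v ^+ 3 * ((1 - k) * v)); first by rewrite /e4; ring.
  by rewrite uvE; transitivity ((1 - k) * (1 + k) * u * v * (u * v ^+ 2));
    [ring | rewrite kE /e3; ring].
case: a b => [a0 a1 a2 a3 a4] [b0 b1 b2 b3 b4].
rewrite /veval /= !(zevalD, zevalM) /= zconstN1 zconst0 zconst1 -/e1 -/e2 -/e3 -/e4.
move: (zeval k a0) (zeval k a1) (zeval k a2) (zeval k a3) (zeval k a4) => c0 c1 c2 c3 c4.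
move: (zeval k b0) (zeval k b1) (zeval k b2) (zeval k b3) (zeval k b4) => d0 d1 d2 d3 d4.
transitivity (
    c0 * d0 + (c0 * d1 + c1 * d0) * e1 + (c0 * d2 + c2 * d0) * e2 + (c0 * d3 + c3 * d0) * e3 +
    (c0 * d4 + c4 * d0) * e4 + c1 * d1 * (e1 * e1) + (c1 * d2 + c2 * d1) * (e1 * e2) + (c1 *
    d3 + c3 * d1) * (e1 * e3) + (c1 * d4 + c4 * d1) * (e1 * e4) + c2 * d2 * (e2 * e2) + (c2 *
    d3 + c3 * d2) * (e2 * e3) + (c2 * d4 + c4 * d2) * (e2 * e4) + c3 * d3 * (e3 * e3) + (c3 *
    d4 + c4 * d3) * (e3 * e4) + c4 * d4 * (e4 * e4)); last by ring.
by rewrite e11 e12 e13 e14 e22 e23 e24 e33 e34 e44; ring.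
Qed.

Lemma vevalX a n : veval (vexp a n) = veval a ^+ n.
Proof.
elim: n => [|n IHn]; first by rewrite veval_const /= /zconst /= mulr0 addr0.
by rewrite exprS -IHn -vevalM.
Qed.

Lemma veq_eval a b : veq a b -> veval a = veval b.
Proof.
case: a b => [a0 a1 a2 a3 a4] [b0 b1 b2 b3 b4].
by move=> /and5P[/zeq_eval E0 /zeq_eval E1 /zeq_eval E2 /zeq_eval E3 /zeq_eval E4];
  rewrite /veval /= E0 E1 E2 E3 E4.
Qed.

End VecEval.

Lemma rmorph_zeval (R S : comNzRingType) (f : {rmorphism R -> S}) y p :
  f (zeval y p) = zeval (f y) p.
Proof.
by elim: p => [|c p IHp]; rewrite /= ?rmorph0 // rmorphD rmorphM IHp /zconst rmorph_int.
Qed.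

Lemma zeval_zhom (R : comNzRingType) (k t P : R) p d :
  zeval k zP = P -> t * P = k -> (size p <= d.+1)%N -> zeval k (zhom p d) = zeval t p * P ^+ d.
Proof.
move=> PE tP; elim: p d => [|c p IHp] d /=; first by rewrite mul0r.
rewrite ltnS zevalD zevalZ zevalX PE /= zconst0 add0r => pd.
case: d pd => [|d] pd; last by rewrite IHp //= exprS -tP; ring.
by move: pd; rewrite leqn0 size_eq0 => /eqP -> /=; rewrite !mulr0 !addr0.
Qed.

Lemma U5_section f : U5 f = sec 0 f.
Proof. by apply: fpsP => n; rewrite /= addn0. Qed.

Lemma U5_linear a f : U5 (V a * f) = a * U5 f.
Proof. by rewrite !U5_section section_linear. Qed.

Lemma zeval_zP (R : comNzRingType) (k : R) : zeval k zP = 1 - 4%:R * k - k ^+ 2.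
Proof. by rewrite /zeval /zP /= zconst1 zconstN1 /zconst /=; ring. Qed.

Lemma zeval_PP : zeval kk zP = PP. Proof. exact: zeval_zP. Qed.

Lemma zeval_VPP : zeval (V kk) zP = V PP.
Proof. by rewrite -zeval_PP rmorph_zeval. Qed.

Lemma zeval_VQQ : zeval (V kk) zQ = V QQ.
Proof.
by rewrite -[zeval _ _](rmorph_zeval (@dilate rat 5)) /zeval /zQ /= zconst1 zconstN1;
  congr V; rewrite /QQ; ring.
Qed.

Lemma uu_vv_relation : (1 - V kk) * vv = (1 + V kk) * uu ^+ 2.
Proof.
have := congr1 (@dilate rat 5) rr_ss.
rewrite (rmorphM _ ss) (rmorphM _ (rr ^+ 2)) rmorphXn rmorphB rmorphD rmorph1 /= /vv /uu => E.
transitivity (q ^+ 2 * (V ss * (1 - V kk))); first by ring.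
by rewrite E; ring.
Qed.

Lemma V_kk : uu * vv ^+ 2 = V kk.
Proof.
rewrite /kk (rmorphM _ (q * rr)) (rmorphM _ q) rmorphXn /= qE dilateX /uu /vv -qE.
by ring.
Qed.

Local Notation vec := (veval (V kk) uu vv).
Local Notation vecM := (vevalM uu_vv_relation V_kk).
Local Notation vecX := (vevalX uu_vv_relation V_kk).

(** The basis elements have the form [q^i V(h_i)] with [i = 0, ..., 4], so [U5] retains only the
    first coordinate. *)
Lemma section0_vec a : sec 0 (vec a) = zeval kk (zv0 a).
Proof.
rewrite /veval -!(rmorph_zeval (@dilate rat 5)) /=.
have -> : (1 + V kk) * uu = q * V ((1 + kk) * rr).
  by rewrite (rmorphM _ (1 + kk)) rmorphD rmorph1 /uu /=; ring.
have -> : (1 - V kk) * vv = q ^+ 2 * V ((1 - kk) * ss).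
  by rewrite (rmorphM _ (1 - kk)) rmorphB rmorph1 /vv /=; ring.
have -> : (1 + V kk) * (uu * vv) = q ^+ 3 * V ((1 + kk) * (rr * ss)).
  by rewrite (rmorphM _ (1 + kk)) (rmorphM _ rr) rmorphD rmorph1 /vv /uu /=; ring.
have -> : (1 - V kk) * vv ^+ 2 = q ^+ 4 * V ((1 - kk) * ss ^+ 2).
  by rewrite (rmorphM _ (1 - kk)) rmorphXn rmorphB rmorph1 /vv /=; ring.
have E g h n : V g * (q ^+ n * V h) = q ^+ n * V (g * h).
  by rewrite (rmorphM _ g) mulrCA.
by rewrite -[q in q * V _]expr1 !E expr1 section_combination.
Qed.

Section Certificates.
Local Open Scope Z_scope.

(** This is [x_uu_vv] multiplied by [(1 + k)^3 (1 - k) P^5], which makes every factor a vector with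
    polynomial coordinates; cross-multiplied, it avoids inverting [a_vec]. *)
Lemma x_vecP :
  veq (vmul (vmul (vexp a_vec 3) e2_vec) (vmul (vconst [:: 1; 0; -1]) x_vec))
      (vmul (vmul (vconst zQ) (vexp e1_vec 3)) (vmul b_vec (vconst (zexp zP 5)))).
Proof. by vm_compute. Qed.

Lemma Phi_vecP :
  veq (vmul (vmul a_vec (vexp b_vec 2)) Phi_vec)
      (vconst (zmul (zmul [:: 0; 1; 1] (zexp [:: 1; -1] 2)) (zmul (zexp zP 4) (zexp zQ 5)))).
Proof. by vm_compute. Qed.

(** [P^25 A_j(V x) x^j] with [P = V PP]: five factors [P] clear [A_j(V x)], [5 * j] of them clear
    [x^j], and [20 - 5 * j] remain. *)
Definition modular_term (j : nat) : zvec :=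
  vmul (vconst (zmul (zhom (nth [::] modular_coef j) 5) (zexp zP (20 - 5 * j)))) (vexp x_vec j).

Lemma modularP :
  veq (vexp x_vec 5)
      (vadd (vadd (vadd (vadd (modular_term 0) (modular_term 1)) (modular_term 2))
         (modular_term 3)) (modular_term 4)).
Proof. by vm_compute. Qed.

Lemma U5_xP i : (i < 5)%N ->
  zeq (zv0 (vexp x_vec i)) (zhom (nth [::] U5_x_coef i) (5 * i)).
Proof. by case: i => [|[|[|[|[|]]]]] // _; vm_compute. Qed.

Lemma U5_Phi_xP i : (i < 5)%N ->
  zeq (zv0 (vmul Phi_vec (vexp x_vec i))) (zhom (nth [::] U5_Phi_x_coef i) (5 * i + 9)).
Proof. by case: i => [|[|[|[|[|]]]]] // _; vm_compute. Qed.

End Certificates.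

Lemma uu_neq0 : 1 - uu - uu ^+ 2 != 0.
Proof.
apply/eqP => E; have := euler_unit 1; rewrite euler1_uu E mulr0 unitr0 //.
Qed.

Lemma vv_neq0 : 1 - vv - vv ^+ 2 != 0.
Proof.
apply/eqP => E; have := euler_unit 2; rewrite euler2_vv E mulr0 unitr0 //.
Qed.

Lemma unit_neq0 (f : qseries) : f \is a GRing.unit -> f != 0.
Proof. by apply: contraTneq => ->; rewrite unitr0. Qed.

Lemma V_kk1_unit : 1 + V kk \is a GRing.unit.
Proof. by rewrite -(rmorph1 (@dilate rat 5)) -rmorphD; apply/dilate_unit/kk1_unit. Qed.

Lemma V_kkm1_unit : 1 - V kk \is a GRing.unit.
Proof. by rewrite -(rmorph1 (@dilate rat 5)) -rmorphB; apply/dilate_unit/kkm1_unit. Qed.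

Lemma vec_a : vec a_vec = (1 + V kk) * (1 - uu - uu ^+ 2).
Proof. by rewrite /veval /= zconst1 zconstN1 uu_vv_relation; ring. Qed.

Lemma vec_b : vec b_vec = (1 - V kk) * (1 - vv - vv ^+ 2).
Proof. by rewrite /veval /= zconst1 zconstN1; ring. Qed.

Lemma vec_e1 : vec e1_vec = (1 + V kk) * uu.
Proof. by rewrite /veval /= zconst1; ring. Qed.

Lemma vec_e2 : vec e2_vec = (1 - V kk) * vv.
Proof. by rewrite /veval /= zconst1; ring. Qed.

Lemma x_vecE : x * V PP ^+ 5 = vec x_vec.
Proof.
have := veq_eval (V kk) uu vv x_vecP.
rewrite !(vecX, vecM) !veval_const zevalX zeval_VPP zeval_VQQ vec_a vec_b vec_e1 vec_e2.
rewrite (_ : zeval _ [:: _; _; _] = 1 - V kk ^+ 2); last first.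
  by rewrite /= zconst1 zconst0 zconstN1; ring.
move: (vec x_vec) => X E2; have := x_uu_vv; rewrite rmorphB rmorph1 rmorphXn /=.
move: (unit_neq0 V_kk1_unit) (unit_neq0 V_kkm1_unit) uu_neq0.
have vv0 : vv != 0 by rewrite mulf_neq0 ?expf_neq0 ?q_neq0 // unit_neq0 // dilate_unit // ss_unit.
move: vv0 E2; move: (V kk) (V PP) (V QQ) x uu vv => k P Q y u v v0 E2 k1 km1 u0 E1.
have c0 : (1 + k) ^+ 3 * (1 - u - u ^+ 2) ^+ 3 * (1 - k) * v * (1 - k ^+ 2) != 0.
  by rewrite -[1 - k ^+ 2](_ : (1 - k) * (1 + k) = _) ?mulf_neq0 ?expf_neq0 //; ring.
apply: (mulfI c0); rewrite [RHS](_ : _ =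
  ((1 + k) * (1 - u - u ^+ 2)) ^+ 3 * ((1 - k) * v) * ((1 - k ^+ 2) * X)); last by ring.
rewrite E2; transitivity ((1 + k) ^+ 3 * (1 - k) * P ^+ 5
   * (y * (1 - u - u ^+ 2) ^+ 3 * v * (1 - k ^+ 2))); first by ring.
by rewrite E1; ring.
Qed.

Lemma Phi_vecE : Phi * (V PP ^+ 4 * V QQ ^+ 5) = vec Phi_vec.
Proof.
have := veq_eval (V kk) uu vv Phi_vecP.
rewrite !(vecX, vecM) !veval_const !(zevalX, zevalM) zeval_VPP zeval_VQQ vec_a vec_b.
rewrite [zeval _ [:: _; _; _]]/= [zeval _ [:: _; _]]/= zconst1 zconst0 zconstN1.
move: (vec Phi_vec) => X E2; have := Phi_uu_vv; move: E2.
move: (unit_neq0 V_kk1_unit) (unit_neq0 V_kkm1_unit) uu_neq0 vv_neq0.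
move: (V kk) (V PP) (V QQ) Phi uu vv => k P Q y u v k1 km1 u0 v0 E2 E1.
have c0 : (1 + k) * (1 - u - u ^+ 2) * ((1 - k) * (1 - v - v ^+ 2)) ^+ 2 != 0.
  by rewrite ?mulf_neq0 ?expf_neq0 // mulf_neq0.
apply: (mulfI c0); rewrite E2.
transitivity ((1 + k) * (1 - k) ^+ 2 * (P ^+ 4 * Q ^+ 5)
   * (y * (1 - u - u ^+ 2) * (1 - v - v ^+ 2) ^+ 2)); first by ring.
by rewrite E1; ring.
Qed.

(** * The modular equation *)

(** It turns the denominator [P^4 Q^5] of [Phi_vec] into [P^9 (1 + 5 x)^5], whence the factor
    [(1 + 5 x)^5] and the degree [5 * i + 9] for [U5 (Phi * x ^+ i)]. *)
Lemma QQ_x : QQ = PP * (1 + 5%:R * x).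
Proof.
transitivity (PP + 5%:R * (x * PP)); last by ring.
by rewrite x_kk /QQ /PP; ring.
Qed.

Local Opaque x Phi PP QQ kk rr ss uu vv.

Lemma x_pow_vecE i : V (PP ^+ (5 * i)) * x ^+ i = vec (vexp x_vec i).
Proof. by rewrite vecX -x_vecE rmorphXn /= [RHS]exprMn -exprM mulrC. Qed.

Lemma U5_x i : (i < 5)%N -> U5 (x ^+ i) = zeval x (nth [::] U5_x_coef i).
Proof.
move=> i5; have U : PP ^+ (5 * i) \is a GRing.unit by apply/unitrX/PP_unit.
apply: (mulrI U); rewrite -U5_linear x_pow_vecE U5_section section0_vec.
rewrite (zeq_eval _ (U5_xP i5)).
rewrite (zeval_zhom zeval_PP x_kk) 1?mulrC //.
by case: i i5 {U} => [|[|[|[|[|]]]]].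
Qed.

Lemma U5_Phi_x i : (i < 5)%N ->
  (1 + 5%:R * x) ^+ 5 * U5 (Phi * x ^+ i) = zeval x (nth [::] U5_Phi_x_coef i).
Proof.
move=> i5; have U : PP ^+ (5 * i + 9) \is a GRing.unit by apply/unitrX/PP_unit.
apply: (mulrI U).
transitivity (PP ^+ 4 * QQ ^+ 5 * PP ^+ (5 * i) * U5 (Phi * x ^+ i)).
  by rewrite QQ_x exprMn exprD -[9%N]/(4 + 5)%N exprD; ring.
rewrite -U5_linear (rmorphM _ (_ * _)) (rmorphM _ (PP ^+ 4)) !(rmorphXn _ 4) (rmorphXn _ 5) /=.
have -> : V PP ^+ 4 * V QQ ^+ 5 * V (PP ^+ (5 * i)) * (Phi * x ^+ i)
    = Phi * (V PP ^+ 4 * V QQ ^+ 5) * (V (PP ^+ (5 * i)) * x ^+ i) by ring.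
rewrite Phi_vecE x_pow_vecE -vecM U5_section section0_vec.
rewrite (zeq_eval _ (U5_Phi_xP i5)).
rewrite (zeval_zhom zeval_PP x_kk) 1?mulrC //.
by case: i i5 {U} => [|[|[|[|[|]]]]].
Qed.

Lemma modular_equation :
  x ^+ 5 = \sum_(j < 5) zeval (V x) (nth [::] modular_coef j) * x ^+ j.
Proof.
have Vx_kk : V x * V PP = V kk by rewrite -rmorphM x_kk.
have U : V (PP ^+ 25) \is a GRing.unit by apply/dilate_unit/unitrX/PP_unit.
apply: (mulrI U); rewrite (x_pow_vecE 5) (veq_eval _ _ _ modularP).
have hom j : (j < 5)%N -> zeval (V kk) (zhom (nth [::] modular_coef j) 5)
    = zeval (V x) (nth [::] modular_coef j) * V PP ^+ 5.
  move=> j5; apply: zeval_zhom; rewrite ?zeval_VPP //.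
  by case: j j5 => [|[|[|[|[|]]]]].
have term j : (j < 5)%N ->
    vec (modular_term j) = V (PP ^+ 25) * (zeval (V x) (nth [::] modular_coef j) * x ^+ j).
  move=> j5; rewrite /modular_term vecM veval_const zevalM hom // zevalX zeval_VPP.
  rewrite -x_pow_vecE !(rmorphXn (@dilate rat 5)) /=.
  have -> : (25 = 5 + ((20 - 5 * j) + 5 * j))%N by lia.
  by rewrite !(exprD (V PP)); ring.
have sum5 (F : nat -> qseries) : \sum_(j < 5) F j = F 0%N + F 1%N + F 2%N + F 3%N + F 4%N.
  by rewrite !big_ord_recr big_ord0 /= add0r.
rewrite (sum5 (fun j => zeval (V x) (nth [::] modular_coef j) * x ^+ j)) !vevalD !term //.
have dist (c a0 a1 a2 a3 a4 : qseries) :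
    c * a0 + c * a1 + c * a2 + c * a3 + c * a4 = c * (a0 + a1 + a2 + a3 + a4) by ring.
exact: dist.
Qed.

(** * Action of U5 on powers of x *)

Local Notation dvd5 v c := ((5 ^+ v : int) %| c)%Z.

Definition ev (y : qseries) (p : {poly int}) : qseries := (map_poly intr p).[y].

Section Ev.
Variable y : qseries.

Lemma ev_is_zmod : zmod_morphism (ev y).
Proof. by move=> p r; rewrite /ev rmorphB hornerD hornerN. Qed.

Lemma ev_is_monoid : monoid_morphism (ev y).
Proof. by split=> [|p r]; rewrite /ev ?rmorph1 ?hornerC // rmorphM hornerM. Qed.

HB.instance Definition _ := GRing.isZmodMorphism.Build {poly int} qseries (ev y) ev_is_zmod.
HB.instance Definition _ := GRing.isMonoidMorphism.Build {poly int} qseries (ev y) ev_is_monoid.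

Lemma evX : ev y 'X = y.
Proof. by rewrite /ev map_polyX hornerX. Qed.

Lemma evC c : ev y c%:P = c%:~R.
Proof. by rewrite /ev map_polyC hornerC. Qed.

Lemma ev_coef p : ev y p = \sum_(i < size p) (p`_i)%:~R * y ^+ i.
Proof.
rewrite -{1}[p]coefK poly_def rmorph_sum /=; apply: eq_bigr => i _.
by rewrite -mul_polyC rmorphM rmorphXn /= evX evC.
Qed.

Lemma ev_Poly s : ev y (Poly (map int_of_Z s)) = zeval y s.
Proof.
elim: s => [|c s IHs]; first by rewrite rmorph0.
by rewrite /= cons_poly_def rmorphD rmorphM /= IHs evX evC addrC mulrC.
Qed.

End Ev.

Lemma rmorph_ev (f : {rmorphism qseries -> qseries}) y p : f (ev y p) = ev (f y) p.
Proof.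
by rewrite !ev_coef rmorph_sum; apply: eq_bigr => i _; rewrite rmorphM rmorphXn rmorph_int.
Qed.

Definition zpoly (s : seq Z) : {poly int} := Poly (map int_of_Z s).
Definition modular_poly (j : nat) := zpoly (nth [::] modular_coef j).

Lemma U5D f g : U5 (f + g) = U5 f + U5 g. Proof. exact: fpsP. Qed.

Lemma U5_0 : U5 0 = 0. Proof. exact: fpsP. Qed.

Lemma U5_sum n (F : nat -> qseries) : U5 (\sum_(j < n) F j) = \sum_(j < n) U5 (F j).
Proof.
by elim: n => [|n IHn]; rewrite ?big_ord0 ?U5_0 // !big_ord_recr U5D IHn.
Qed.

(** The coefficients of the modular equation are polynomials in [V x], so they leave [U5] as
    polynomials in [x]. *)
Lemma modular_recurrence (g : qseries) m :
  U5 (g * x ^+ (m + 5)) = \sum_(j < 5) ev x (modular_poly j) * U5 (g * x ^+ (m + j)).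
Proof.
rewrite exprD modular_equation mulrA mulr_sumr.
rewrite (U5_sum 5 (fun j => g * x ^+ m * (zeval (V x) (nth [::] modular_coef j) * x ^+ j))).
apply: eq_bigr => j _; rewrite -U5_linear (rmorph_ev (@dilate rat 5)) ev_Poly exprD; congr U5.
by ring.
Qed.

Lemma dvd5_le u v (c : int) : (u <= v)%N -> dvd5 v c -> dvd5 u c.
Proof. by move=> uv; apply: dvdz_trans; apply: dvdz_exp2l. Qed.

Section Divisibility.
Local Open Scope Z_scope.

Definition z5exp (v : nat) : Z := iter v (Z.mul 5) 1.

Definition z5dvd (v : nat) (c : Z) : bool := Z.eqb (Z.mul (Z.div c (z5exp v)) (z5exp v)) c.

Definition z5dvd_poly (v : nat -> nat) (s : seq Z) : bool :=
  all (fun r => z5dvd (v r) (nth 0 s r)) (iota 0 (size s)).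

End Divisibility.

Lemma z5dvdP v c : z5dvd v c -> dvd5 v (int_of_Z c).
Proof.
move/Z.eqb_spec => <-; rewrite (rmorphM int_of_Z) dvdz_mull //=.
suff -> : int_of_Z (z5exp v) = 5 ^+ v by [].
by elim: v => // v IHv; rewrite exprS -IHv; exact: (rmorphM int_of_Z _ (z5exp v)).
Qed.

Lemma z5dvd_polyP v s r : z5dvd_poly v s -> dvd5 (v r) (zpoly s)`_r.
Proof.
move=> /allP dvd_s; rewrite coef_Poly; have [rs|sr] := ltnP r (size s).
  by rewrite (nth_map Z0) //; apply/z5dvdP/dvd_s; rewrite mem_iota.
by rewrite nth_default ?dvdz0 ?size_map.
Qed.

Lemma modular_dvd j r : (j < 5)%N -> dvd5 ((5 * r + j) %/ 6) (modular_poly j)`_r.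
Proof.
move=> j5; apply: (@z5dvd_polyP (fun r => (5 * r + j) %/ 6)%N).
by case: j j5 => [|[|[|[|[|]]]]] // _; vm_compute.
Qed.

Section Recurrence.
Variables (g h : qseries) (c : nat).

(** The slope 5/6 is that of [modular_dvd]. The offset [c] is dictated by the cases [m < 5]: 1 for
    [U5 (x ^+ m)] and 10 with [Phi], where 9 fails at the entry 794 of [U5_Phi_x_coef]. Truncated
    subtraction makes the condition void for small [r]. *)
Definition U5_bounded (m : nat) := exists2 p : {poly int},
  h * U5 (g * x ^+ m) = ev x p & forall r, dvd5 ((5 * r - m - c) %/ 6) p`_r.

Hypothesis base : forall i, (i < 5)%N -> U5_bounded i.

Lemma U5_boundedP m : U5_bounded m.
Proof.
have [n] := ubnP m; elim: n m => // n IHn m mn.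
have [m5|m5] := ltnP m 5; first exact: base.
have [k mk] : exists k, (m = k + 5)%N by exists (m - 5)%N; lia.
have : forall j : 'I_5, U5_bounded (k + j).
  by move=> j; apply: IHn; have := ltn_ord j; lia.
move=> /fin_all_exists2[p pE p_dvd].
exists (\sum_(j < 5) modular_poly j * p j) => [|r].
  rewrite mk modular_recurrence mulr_sumr rmorph_sum; apply: eq_bigr => j _.
  by rewrite rmorphM /= -pE mulrCA.
rewrite coef_sum; apply: rpred_sum => j _; rewrite coefM; apply: rpred_sum => l _.
(* The two floors lose at most 5 in the numerator, which is exactly [m - k]. *)
apply: (@dvd5_le _ ((5 * l + j) %/ 6 + (5 * (r - l) - (k + j) - c) %/ 6)).
  by have := ltn_ord l; have := ltn_ord j; lia.
by rewrite exprD dvdz_mul // modular_dvd.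
Qed.

End Recurrence.

Lemma U5_x_bounded m : U5_bounded 1 1 1 m.
Proof.
apply: U5_boundedP => i i5; exists (zpoly (nth [::] U5_x_coef i)) => [|r].
  by rewrite !mul1r ev_Poly U5_x.
apply: (@z5dvd_polyP (fun r => (5 * r - i - 1) %/ 6)%N).
by case: i i5 => [|[|[|[|[|]]]]] // _; vm_compute.
Qed.

Lemma U5_Phi_x_bounded m : U5_bounded Phi ((1 + 5%:R * x) ^+ 5) 10 m.
Proof.
apply: U5_boundedP => i i5; exists (zpoly (nth [::] U5_Phi_x_coef i)) => [|r].
  by rewrite ev_Poly U5_Phi_x.
apply: (@z5dvd_polyP (fun r => (5 * r - i - 10) %/ 6)%N).
by case: i i5 => [|[|[|[|[|]]]]] // _; vm_compute.
Qed.

(** * Localization at 1 + 5 x *)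

Definition x5 : qseries := 1 + 5%:R * x.

(* The ring generated by x and the V p for p in Z[x]. *)
Definition Vpoly (f : qseries) : Prop :=
  exists n (s : nat -> {poly int}), f = \sum_(j < n) V (ev x (s j)) * x ^+ j.

Lemma VpolyD f g : Vpoly f -> Vpoly g -> Vpoly (f + g).
Proof.
have widen n m (s : nat -> {poly int}) : (n <= m)%N ->
    \sum_(j < n) V (ev x (s j)) * x ^+ j
    = \sum_(j < m) V (ev x (if (j < n)%N then s j else 0)) * x ^+ j.
  move=> nm; rewrite (big_ord_widen m (fun j => V (ev x (s j)) * x ^+ j) nm) big_mkcond.
  by apply: eq_bigr => j _; case: ifP; rewrite ?rmorph0 ?mul0r.
move=> [n [s ->]] [m [t ->]].
rewrite (widen n (n + m)%N) ?leq_addr // (widen m (n + m)%N) ?leq_addl // -big_split.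
exists (n + m)%N, (fun j => (if (j < n)%N then s j else 0) + (if (j < m)%N then t j else 0)).
by apply: eq_bigr => j _; rewrite !rmorphD mulrDl.
Qed.

Lemma Vpoly0 : Vpoly 0.
Proof. by exists 0%N, (fun=> 0); rewrite big_ord0. Qed.

Lemma Vpoly_sum n (F : nat -> qseries) :
  (forall j, (j < n)%N -> Vpoly (F j)) -> Vpoly (\sum_(j < n) F j).
Proof.
elim: n => [|n IHn] VF; first by rewrite big_ord0; apply: Vpoly0.
by rewrite big_ord_recr; apply: VpolyD; [apply: IHn => j ?; apply: VF; lia | apply: VF].
Qed.

Lemma Vpoly_term c j : Vpoly (V (ev x c) * x ^+ j).
Proof.
exists j.+1, (fun i => if i == j then c else 0).
rewrite big_ord_recr /= eqxx big1 ?add0r // => i _.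
by rewrite ltn_eqF // !rmorph0 mul0r.
Qed.

Lemma VpolyM f g : Vpoly f -> Vpoly g -> Vpoly (f * g).
Proof.
move=> [n [s ->]] [m [t ->]]; set h := \sum_(j < m) _; rewrite mulr_suml.
apply: (@Vpoly_sum n (fun i => V (ev x (s i)) * x ^+ i * h)) => i _; rewrite mulr_sumr.
apply: (@Vpoly_sum m (fun j => V (ev x (s i)) * x ^+ i * (V (ev x (t j)) * x ^+ j))) => j _.
by rewrite mulrACA -exprD -!rmorphM; apply: Vpoly_term.
Qed.

Lemma Vpoly_V c : Vpoly (V (ev x c)).
Proof. by rewrite -[V _]mulr1 -(expr0 x); apply: Vpoly_term. Qed.

Lemma Vpoly_x : Vpoly x.
Proof.
have := Vpoly_term 1 1; rewrite !rmorph1 mul1r expr1; exact.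
Qed.

Lemma Vpoly_int (c : int) : Vpoly c%:~R.
Proof. by have := Vpoly_V c%:P; rewrite evC rmorph_int. Qed.

Lemma VpolyX f n : Vpoly f -> Vpoly (f ^+ n).
Proof.
move=> Vf; elim: n => [|n IHn]; first exact: (Vpoly_int 1).
by rewrite exprS; apply: VpolyM.
Qed.

Lemma Vpoly_ev p : Vpoly (ev x p).
Proof.
rewrite ev_coef; apply: (@Vpoly_sum _ (fun i => (p`_i)%:~R * x ^+ i)) => i _.
by apply: VpolyM; [apply: Vpoly_int | apply/VpolyX/Vpoly_x].
Qed.

Lemma VpolyN f : Vpoly f -> Vpoly (- f).
Proof. by move=> Vf; rewrite -mulN1r; apply: VpolyM Vf; apply: (Vpoly_int (-1)). Qed.

Section ModularAt.
Local Open Scope Z_scope.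
Local Notation A j := (nth [::] modular_coef j).
Local Notation z5 := [:: 5].

Lemma modular_at_certificate :
  zeq (zexp [:: 1; 5] 5)
    (zadd [:: 1] (zadd
       (zadd (zmul z5 (A 4)) (zadd (zmul (zexp z5 3) (A 2)) (zmul (zexp z5 5) (A 0))))
       (zopp (zadd (zmul (zexp z5 2) (A 3)) (zmul (zexp z5 4) (A 1)))))).
Proof. by vm_compute. Qed.
End ModularAt.

Lemma modular_at (R : comNzRingType) (t : R) (a : nat -> R) :
  (forall j, a j = zeval t (nth [::] modular_coef j)) ->
  (1 + 5%:R * t) ^+ 5 = 1 + (5%:R * a 4%N + 5%:R ^+ 3 * a 2%N + 5%:R ^+ 5 * a 0%N)
    - (5%:R ^+ 2 * a 3%N + 5%:R ^+ 4 * a 1%N).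
Proof.
move=> aE; have z5E : zeval t [:: Zpos (xI (xO xH))] = 5%:R by rewrite /= mulr0 addr0.
have z15E : zeval t [:: Zpos xH; Zpos (xI (xO xH))] = 1 + 5%:R * t.
  by rewrite /= mulr0 addr0 mulrC.
have z1E : zeval t [:: Zpos xH] = 1 by rewrite /= mulr0 addr0.
have zN p : zeval t (zopp p) = - zeval t p by rewrite zevalZ zconstN1 mulN1r.
rewrite -z15E -zevalX; apply: etrans (zeq_eval t modular_at_certificate) _.
rewrite zevalD z1E zevalD zevalD zevalM zevalD zevalM zevalX zevalM zevalX zN.
rewrite zevalD zevalM zevalX zevalM zevalX !z5E -!aE.
by move: a {aE} => a; ring.
Qed.

(* Writing the modular equation as F(x, V x) = 0, one has
   5^5 F(- 1/5, t) = - (1 + 5 t)^5. *)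
Lemma x5_cofactor : exists2 f, Vpoly f & x5 * f = V x5 ^+ 5.
Proof.
pose b j := V (ev x (5%:R ^+ (5 - j) * modular_poly j)).
have Vb j : Vpoly (b j) by apply: Vpoly_V.
pose y := 5%:R * x.
have Vy : Vpoly y by apply: VpolyM; [apply: (Vpoly_int 5) | apply: Vpoly_x].
pose c j := zeval (V x) (nth [::] modular_coef j).
have bE j : b j = 5%:R ^+ (5 - j) * c j.
  rewrite /b rmorphM (rmorphM (@dilate rat 5)) !rmorphXn !rmorph_nat (rmorph_ev (@dilate rat 5)).
  by rewrite ev_Poly.
have yE : y ^+ 5 = b 0%N + b 1%N * y + b 2%N * y ^+ 2 + b 3%N * y ^+ 3 + b 4%N * y ^+ 4.
  rewrite /y exprMn modular_equation !bE -/(\sum_(j < 5) c j * x ^+ j).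
  by move: c {Vb bE} => c; rewrite !big_ord_recr big_ord0 /=; ring.
have xE : V x5 ^+ 5 = 1 + b 4%N - b 3%N + b 2%N - b 1%N + b 0%N.
  rewrite /x5 rmorphD rmorph1 (rmorphM _ 5%:R) rmorph_nat /= !bE.
  rewrite (@modular_at _ _ c) // expr1.
  by move: c {Vb bE yE} => c; ring.
have yx : y = 5%:R * x by [].
move: b y {bE} Vb Vy yE xE yx => b y Vb Vy yE xE yx.
(* Synthetic division by [Y + 1]: for [G(Y) = Y^5 - sum_j b_j Y^j], these are the lower coefficients
   of [(G(Y) - G(-1)) / (Y + 1)]. Here [G(y) = 0] and [- G(-1) = V x5 ^+ 5]. *)
pose g3 := - (b 4%N) - 1; pose g2 := - (b 3%N) - g3; pose g1 := - (b 2%N) - g2.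
pose g0 := - (b 1%N) - g1.
have V1 : Vpoly 1 := Vpoly_int 1.
exists (y ^+ 4 + g3 * y ^+ 3 + g2 * y ^+ 2 + g1 * y + g0).
  by rewrite /g0 /g1 /g2 /g3; do ?[exact: Vb | exact: Vy | exact: V1 | apply: VpolyD | apply: VpolyN | apply: VpolyX | apply: VpolyM]. 
rewrite xE /x5 -yx.
transitivity (y ^+ 5 - (b 0%N + b 1%N * y + b 2%N * y ^+ 2 + b 3%N * y ^+ 3 + b 4%N * y ^+ 4)
   + (1 + b 4%N - b 3%N + b 2%N - b 1%N + b 0%N)).
  by rewrite /g0 /g1 /g2 /g3; ring.
by rewrite yE subrr add0r.
Qed.

Lemma U5_Vpoly g h c f : (forall m, U5_bounded g h c m) -> Vpoly f ->
  exists p, h * U5 (g * f) = ev x p.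
Proof.
move=> gb [n [s ->]]; rewrite mulr_sumr.
rewrite (U5_sum n (fun j => g * (V (ev x (s j)) * x ^+ j))) mulr_sumr.
have: forall j : 'I_n, exists p, h * U5 (g * x ^+ j) = ev x p.
  by move=> j; have [p pE _] := gb j; exists p.
move=> /fin_all_exists[p pE].
exists (\sum_(j < n) s j * p j); rewrite rmorph_sum; apply: eq_bigr => j _.
by rewrite mulrCA U5_linear mulrCA pE rmorphM.
Qed.

(** Inside [U5] the factor [x5 ^+ (5 * n)] becomes [V x5 ^+ (5 * n)], which equals
    [x5 ^+ n * e ^+ n]: the first part clears the denominator of [f], the second stays in
    [Vpoly]. *)
Lemma U5_localized g h c f n p : (forall m, U5_bounded g h c m) ->
  x5 ^+ n * f = ev x p -> exists p', x5 ^+ (5 * n) * (h * U5 (g * f)) = ev x p'.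
Proof.
move=> gb fE; have [e Ve eE] := x5_cofactor.
have [|p' p'E] := @U5_Vpoly g h c (ev x p * e ^+ n) gb.
  by apply: VpolyM; [apply: Vpoly_ev | apply: VpolyX].
exists p'; rewrite -p'E mulrCA -[x5 ^+ _ * U5 _]U5_linear -fE; congr (h * U5 _).
rewrite (rmorphXn (@dilate rat 5)) exprM /= -eE exprMn; ring.
Qed.

Fixpoint pole_order (alpha : nat) : nat :=
  if alpha is a.+1 then (5 * pole_order a + (~~ odd a) * 5)%N else 0%N.

Lemma pole_order_double b :
  (24 * pole_order (2 * b) + 25 = 25 ^ b.+1 /\ 24 * pole_order (2 * b).+1 + 5 = 5 * 25 ^ b.+1)%N.
Proof.
have S c : (24 * pole_order (2 * c) + 25 = 25 ^ c.+1 ->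
    24 * pole_order (2 * c).+1 + 5 = 5 * 25 ^ c.+1)%N.
  by move=> <- /=; rewrite oddM /=; lia.
elim: b => [|b [IH1 IH2]] //.
have E : (24 * pole_order (2 * b.+1) + 25 = 25 ^ b.+2)%N.
  have -> : (2 * b.+1 = (2 * b).+2)%N by lia.
  rewrite [(25 ^ _)%N]expnS; move: IH2; set n := pole_order (2 * b).+1.
  have -> : pole_order (2 * b).+2 = (5 * n + ~~ odd (2 * b).+1 * 5)%N by [].
  by rewrite /= oddM /=; lia.
by split; [exact: E | exact: S].
Qed.

(** [5 ^ (alpha + 2)] is [24 * pole_order alpha] plus 5 for odd [alpha] and plus 25 for even
    [alpha]. The floor is therefore exact or too large by 1, and [1 - gcd] corrects it. *)
Lemma psi_pole_order alpha : (0 < alpha)%N -> psi alpha = pole_order alpha.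
Proof.
move=> a0; rewrite /psi; have := odd_double_half alpha; rewrite -mul2n.
set b := alpha./2; have [E1 E2] := pole_order_double b.
case: (odd alpha) => [|] /= aE; move: E1 E2; rewrite -?aE ?add1n ?add0n.
- have -> : gcdn (2 * b).+1 2 = 1%N by rewrite -addn1 gcdnC mulnC gcdnMDl.
  have -> : (5 ^ ((2 * b).+1 + 2) = 5 * 25 ^ b.+1)%N.
    have -> : ((2 * b).+1 + 2 = (2 * b.+1).+1)%N by lia.
    by rewrite expnS expnM.
  by move=> _ <-; lia.
- have b0 : (0 < b)%N by lia.
  have -> : gcdn (2 * b) 2 = 2%N by rewrite gcdnC; apply/gcdn_idPl/dvdn_mulr.
  have -> : (5 ^ (2 * b + 2) = 25 ^ b.+1)%N.
    have -> : (2 * b + 2 = 2 * b.+1)%N by lia.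
    by rewrite expnM.
  move=> <- _.
  have : (0 < pole_order (2 * b))%N.
    by case: b b0 {aE} => // c _; rewrite mulnS /=; lia.
  lia.
Qed.

Lemma L_localized alpha : exists p, x5 ^+ pole_order alpha * L alpha = ev x p.
Proof.
elim: alpha => [|a [p IH]]; first by exists 1; rewrite rmorph1 mulr1.
rewrite /=; case: ifP => a_odd /=; rewrite ?mul0n ?mul1n ?addn0.
  have [p' E] := U5_localized U5_x_bounded IH; exists p'.
  by rewrite -E !mul1r.
have [p' E] := U5_localized U5_Phi_x_bounded IH; exists p'.
by rewrite -E exprD mulrA.
Qed.

(** * 5-adic estimates *)

Lemma fpscoef_intM (c : int) (f : qseries) n : fpscoef (c%:~R * f) n = c%:~R * fpscoef f n.
Proof.
have natM k : fpscoef (f *+ k) n = fpscoef f n *+ k.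
  by elim: k => // k IHk; rewrite !mulrS fpscoefD IHk.
by rewrite !mulrzl; case: c => k; rewrite -?pmulrn ?NegzE ?mulrNz -?pmulrn ?fpscoefN natM.
Qed.

(** Since [x = q + O(q^2)], the passage from powers of [x] to powers of [q] is unitriangular. *)
Lemma fpscoef_ev (p : {poly int}) n : (forall i, (i < n)%N -> p`_i = 0) ->
  fpscoef (ev x p) n = (p`_n)%:~R.
Proof.
move=> p0; rewrite ev_coef fpscoef_sum.
have term i : fpscoef ((p`_i)%:~R * x ^+ i) n = if i == n then (p`_n)%:~R else 0.
  rewrite fpscoef_intM; case: eqP => [->|/eqP i_n]; first by rewrite x_pow_coef mulr1.
  have [lt_in|lt_ni|/eqP] := ltngtP i n; rewrite ?(negbTE i_n) //.
    by rewrite p0 ?mul0r.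
  by rewrite fpscoefX_lt ?x_coef0 ?mulr0.
under eq_bigr do rewrite term.
rewrite -big_mkcond /=.
have [nlt|] := ltnP n (size p); first by rewrite (big_pred1 (Ordinal nlt)).
by move=> le_pn; rewrite nth_default // big1.
Qed.

Lemma ev_eqmod0 N (p : {poly int}) : fps_eqmod N (ev x p) 0 -> forall i, (i < N)%N -> p`_i = 0.
Proof.
move=> pN i; elim/ltn_ind: i => i IH iN.
have := pN i iN; rewrite fpscoef_ev => [/eqP|j ji]; last by apply: IH => //; lia.
by rewrite intr_eq0 => /eqP.
Qed.

Lemma ev_eqmod N (p r : {poly int}) : fps_eqmod N (ev x p) (ev x r) -> forall i, (i < N)%N -> p`_i = r`_i.
Proof.
move=> pr i iN; apply/eqP; rewrite -subr_eq0 -coefB; apply/eqP.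
apply: (@ev_eqmod0 N) => // n nN.
by rewrite rmorphB fpscoefB pr ?subrr.
Qed.

Lemma ev_inj : injective (ev x).
Proof. by move=> p r pr; apply/polyP => i; apply: (@ev_eqmod i.+1); rewrite ?pr. Qed.

(** The weight asks nothing of the coefficients up to [x^3], and could not: the coefficient of [x^3]
    in [U5 Phi] is 794 modulo 5. *)
Definition weighted (p : {poly int}) := forall m, dvd5 (m %/ 4) p`_m.

(* U5(x^m) = x mod 5 for m = 1, 2, 3, whence the condition on the sum. *)
Definition weighted_odd (p : {poly int}) :=
  [/\ weighted p, p`_0 = 0 & dvd5 1 (p`_1 + p`_2 + p`_3)].

(* The closure of a lattice of polynomials in x, inside Z[[x]] = Z[[q]]. *)
Definition approx (T : {poly int} -> Prop) (f : qseries) :=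
  forall N, exists2 p, fps_eqmod N f (ev x p) & T p.

Lemma U5_eqmod N f g : fps_eqmod (5 * N) f g -> fps_eqmod N (U5 f) (U5 g).
Proof. by move=> fg; rewrite !U5_section; apply: fps_eqmod_section. Qed.

Lemma ev_coef_wide y n (p : {poly int}) : (size p <= n)%N ->
  ev y p = \sum_(i < n) (p`_i)%:~R * y ^+ i.
Proof.
move=> pn; rewrite ev_coef (big_ord_widen n (fun i => (p`_i)%:~R * y ^+ i) pn) big_mkcond.
by apply: eq_bigr => i _; case: ltnP => // pi; rewrite nth_default ?mul0r.
Qed.

(** The upper bound [4 + size p] lets [approx_U5] split off the terms [m < 4] whatever the degree of
    [p]. *)
Lemma U5_ev g h c (p : {poly int}) : (forall m, U5_bounded g h c m) ->
  exists w : nat -> {poly int},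
  [/\ forall m, h * U5 (g * x ^+ m) = ev x (w m),
      forall m r, dvd5 ((5 * r - m - c) %/ 6) (w m)`_r &
      h * U5 (g * ev x p) = ev x (\sum_(m < 4 + size p) p`_m *: w m)].
Proof.
move=> gb; have /boolp.choice[w wE] : forall m, exists r : {poly int},
    h * U5 (g * x ^+ m) = ev x r /\ forall i, dvd5 ((5 * i - m - c) %/ 6) r`_i.
  by move=> m; have [r rE rD] := gb m; exists r.
exists w; split=> [m|m r|]; [by case: (wE m)|by case: (wE m)|].
rewrite (ev_coef_wide _ (leq_addl 4 _)) mulr_sumr (U5_sum _ (fun m => g * ((p`_m)%:~R * x ^+ m))) mulr_sumr rmorph_sum.
apply: eq_bigr => m _; have [wm _] := wE m.
have -> : (p`_m)%:~R = V (ev x (p`_m)%:P) by rewrite evC rmorph_int.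
by rewrite mulrCA U5_linear mulrCA wm -mul_polyC rmorphM.
Qed.

Lemma dvd5D v (a b : int) : dvd5 v a -> dvd5 v b -> dvd5 v (a + b).
Proof. exact: rpredD. Qed.

Lemma weighted_oddD p r : weighted_odd p -> weighted_odd r -> weighted_odd (p + r).
Proof.
move=> [wp p0 p1] [wr r0 r1]; split=> [m||].
- by rewrite coefD dvd5D.
- by rewrite coefD p0 r0.
rewrite !coefD (_ : _ + _ = p`_1 + p`_2 + p`_3 + (r`_1 + r`_2 + r`_3)); last by ring.
exact: dvd5D.
Qed.

(** The factor 5 pays for the shift of the index and makes the sum divisible by 5. *)
Lemma weighted_odd_5X p : weighted_odd p -> weighted_odd (- 5%:R *: 'X * p).
Proof.
move=> [wp p0 p1]; have c m : (- 5%:R *: 'X * p)`_m = - 5%:R * (if m is m'.+1 then p`_m' else 0).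
  by rewrite -scalerAl coefZ coefXM; case: m.
split=> [m||]; rewrite ?c ?mulr0 //.
  case: m => [|m]; rewrite ?mulr0 ?dvdz0 //.
  rewrite mulNr rpredN; apply: (@dvd5_le _ (1 + m %/ 4)); first by lia.
  by rewrite exprD dvdz_mul.
rewrite !mulNr -!opprD rpredN -!mulrDr; exact: dvdz_mulr.
Qed.

(** The inverse of [1 + 5 x] is the geometric series in [- 5 x], and multiplication by [- 5 x]
    preserves [weighted_odd]. *)
Lemma approx_divx5 f : approx weighted_odd (x5 * f) -> approx weighted_odd f.
Proof.
move=> af N; have [p fp wp] := af N.
pose y := - 5%:R *: 'X : {poly int}.
exists (\sum_(i < N) y ^+ i * p); last first.
  elim: N {fp} => [|n IHn]; last first.
    rewrite big_ord_recr; apply: weighted_oddD => //.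
    elim: n {IHn} => [|n IHn]; first by rewrite mul1r.
    by rewrite exprS -mulrA; apply: weighted_odd_5X.
  by rewrite big_ord0; split=> [m||]; rewrite ?coef0 ?addr0 ?dvdz0.
have yE : ev x y = - (5%:R * x).
  by rewrite /y -mul_polyC rmorphM /= evX evC rmorphN mulNr.
rewrite -mulr_suml rmorphM rmorph_sum /=.
under eq_bigr do rewrite rmorphXn /= yE.
apply: fps_eqmod_trans (fps_eqmodM (fps_eqmod_refl _) fp); rewrite mulrA.
rewrite -[X in fps_eqmod _ X]mul1r; apply: fps_eqmodM => //.
have -> : (\sum_(i < N) (- (5%:R * x)) ^+ i) * x5 = 1 - (- (5%:R * x)) ^+ N.
  rewrite -opprB subrX1 /x5; move: (\sum_(i < N) _) => s; ring.
move=> n nN; rewrite fpscoefB fpscoefX_lt ?subr0 //.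
by rewrite fpscoefN fpscoef0M x_coef0 mulr0 oppr0.
Qed.

(** The factor [x5 ^+ 5] makes the images of the powers of [x] polynomial; it is then removed one
    factor at a time. *)
Lemma approx_U5_Phi f : approx weighted f -> approx weighted_odd (U5 (Phi * f)).
Proof.
move=> af; suff: approx weighted_odd (x5 ^+ 5 * U5 (Phi * f)).
  by elim: (5%N) => [|n IHn]; rewrite ?mul1r // exprS -mulrA => /approx_divx5.
move=> N; have [p fp wp] := af (5 * N)%N.
have [w [wE w_dvd wp_ev]] := U5_ev p U5_Phi_x_bounded.
exists (\sum_(m < 4 + size p) p`_m *: w m).
  rewrite -wp_ev; apply: fps_eqmodM => //; apply/U5_eqmod.
  exact: fps_eqmodM.
have w0 m : (w m)`_0 = 0.
  have U0 : fpscoef (U5 (Phi * x ^+ m)) 0 = 0.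
    by change (fpscoef (Phi * x ^+ m) 0 = 0); rewrite fpscoef0M Phi_coef0 mul0r.
  have /(congr1 (fun f => fpscoef f 0)) := wE m.
  by rewrite fpscoef_ev // fpscoef0M U0 mulr0 => /esym/eqP; rewrite intr_eq0 => /eqP.
(* The sums are 835, 9605, 35385 and 59200. From [m = 4] on, the factor 5 comes from the coefficient
   of [p] instead. *)
have w123 m : (m < 4)%N -> dvd5 1 ((w m)`_1 + (w m)`_2 + (w m)`_3).
  move=> m4; have -> : w m = zpoly (nth [::] U5_Phi_x_coef m).
    by apply: ev_inj; rewrite -wE ev_Poly -U5_Phi_x //; lia.
  by case: m m4 => [|[|[|[|]]]] // _; rewrite !coef_Poly.
split=> [r||].
- rewrite coef_sum; apply: rpred_sum => m _; rewrite coefZ.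
  apply: (@dvd5_le _ (m %/ 4 + (5 * r - m - 10) %/ 6)); first by lia.
  by rewrite exprD dvdz_mul.
- by rewrite coef_sum big1 // => m _; rewrite coefZ w0 mulr0.
rewrite !coef_sum -!big_split; apply: rpred_sum => m _ /=; rewrite !coefZ -!mulrDr.
have [m4|m4] := ltnP m 4; first by apply/dvdz_mull/w123.
apply: dvdz_mulr; apply: dvd5_le (wp m); lia.
Qed.

Lemma U5_x_mod5 m r : (0 < m < 4)%N -> (r < 4)%N ->
  dvd5 1 ((zpoly (nth [::] U5_x_coef m))`_r - (r == 1%N)%:R).
Proof.
move=> m4 r4; rewrite coef_Poly (nth_map Z0); last first.
  by case: m m4 => [|[|[|[|]]]] // _; apply: leq_trans r4 _.
have -> : (r == 1%N)%:R = int_of_Z (if r == 1%N then Zpos xH else Z0) by case: eqP.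
rewrite -(rmorphB int_of_Z); apply: z5dvdP.
by case: m m4 => [|[|[|[|]]]] // _; case: r r4 => [|[|[|[|]]]] // _; vm_compute.
Qed.

Lemma approx_U5 f : approx weighted_odd f -> exists2 g, U5 f = 5%:R * g & approx weighted g.
Proof.
move=> af; exists (5%:R^-1 * U5 f); first by rewrite mulrA divrr ?mul1r ?five_unit.
move=> N; have [p fp [wp p0 p123]] := af (5 * N)%N.
have [w [wE w_dvd wp_ev]] := U5_ev p U5_x_bounded.
pose s := \sum_(m < 4 + size p) p`_m *: w m.
have {}wp_ev : U5 (ev x p) = ev x s by rewrite -wp_ev !mul1r.
(* For [4 <= r] the valuation bounds already provide the extra 5. For [r < 4] the constant term of
   [p] is 0, the terms [m >= 4] carry a 5 from [p], and [m = 1, 2, 3] together give the coefficient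
   sum of [weighted_odd] times [r == 1], modulo 5. *)
have s_dvd r : dvd5 (r %/ 4).+1 s`_r.
  have [r4|r4] := leqP 4 r.
    rewrite coef_sum; apply: rpred_sum => m _; rewrite coefZ.
    apply: (@dvd5_le _ (m %/ 4 + (5 * r - m - 1) %/ 6)); first by lia.
    by rewrite exprD dvdz_mul.
  rewrite divn_small // coef_sum big_split_ord /=; apply: rpredD; last first.
    apply: rpred_sum => m _; rewrite coefZ; apply: dvdz_mulr.
    by apply: dvd5_le (wp _); lia.
  have wE4 m : (m < 4)%N -> w m = zpoly (nth [::] U5_x_coef m).
    by move=> m4; apply: ev_inj; rewrite -wE ev_Poly -U5_x ?mul1r //; lia.
  rewrite !big_ord_recr big_ord0 /= add0r !coefZ p0 mul0r add0r !wE4 //.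
  have u1 := U5_x_mod5 (isT : (0 < 1 < 4)%N) r4.
  have u2 := U5_x_mod5 (isT : (0 < 2 < 4)%N) r4.
  have u3 := U5_x_mod5 (isT : (0 < 3 < 4)%N) r4.
  move: (zpoly (nth _ _ 1))`_r (zpoly (nth _ _ 2))`_r (zpoly (nth _ _ 3))`_r u1 u2 u3.
  move=> a1 a2 a3 u1 u2 u3.
  rewrite (_ : _ + _ = p`_1 * (a1 - (r == 1)%:R) + p`_2 * (a2 - (r == 1)%:R)
    + p`_3 * (a3 - (r == 1)%:R) + (r == 1)%:R * (p`_1 + p`_2 + p`_3)); last by ring.
  by do !apply: rpredD; apply: dvdz_mull.
pose t := \poly_(i < size s) (s`_i %/ 5)%Z.
have st : s = 5%:R *: t.
  apply/polyP => i; rewrite coefZ coef_poly; case: ltnP => [_|si]; last by rewrite nth_default ?mulr0.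
  rewrite mulrC divzK //; apply: dvdz_trans (s_dvd i); rewrite exprS; exact: dvdz_mulr.
exists t.
  have -> : ev x t = 5%:R^-1 * ev x s.
    rewrite st -mul_polyC rmorphM /= evC; rewrite mulrA [_ * 5%:~R]mulVr ?mul1r //; exact: five_unit.
  by apply: fps_eqmodM => //; rewrite -wp_ev; apply: U5_eqmod.
by move=> m; have := s_dvd m; rewrite st coefZ exprS dvdz_mul2l.
Qed.

Lemma approxT (T : {poly int} -> Prop) f : approx T f -> approx (fun=> True) f.
Proof. by move=> af N; have [p fp _] := af N; exists p. Qed.

Lemma U5_scale n f : U5 (5%:R ^+ n * f) = 5%:R ^+ n * U5 f.
Proof.
by rewrite -U5_linear (rmorphXn (@dilate rat 5)) /= rmorph_nat.
Qed.

Lemma L_double b : exists2 g, L (2 * b) = 5%:R ^+ b * g & approx weighted g.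
Proof.
elim: b => [|b [g Lg ag]].
  exists 1; rewrite ?mulr1 // => N; exists 1; rewrite ?rmorph1 // => m.
  by rewrite coef1; case: m => //= m; rewrite dvdz0.
have -> : (2 * b.+1 = (2 * b).+2)%N by lia.
have [h hE ah] := approx_U5 (approx_U5_Phi ag); exists h => //.
have -> : L (2 * b).+2 = U5 (U5 (Phi * L (2 * b))) by rewrite /= oddM.
by rewrite Lg mulrCA !U5_scale hE exprSr mulrA.
Qed.

(** The step with [Phi] adds no factor 5, whence the floor of [alpha / 2]; it only prepares the sum
    condition for the next [U5]. *)
Lemma L_divisible alpha :
  exists2 g, L alpha = 5%:R ^+ (alpha %/ 2) * g & approx (fun=> True) g.
Proof.
have [g Lg ag] := L_double (alpha %/ 2).
have := divn_eq alpha 2; rewrite modn2 mulnC; move: Lg; set b := (alpha %/ 2)%N => Lg.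
case: (odd alpha) => /= ->; last first.
  by rewrite addn0; exists g => //; apply: approxT ag.
exists (U5 (Phi * g)); last exact: approxT (approx_U5_Phi ag).
have -> : L (2 * b + 1) = U5 (Phi * L (2 * b)) by rewrite addn1 /= oddM.
by rewrite Lg mulrCA U5_scale.
Qed.

Theorem theorem4p3 (alpha : nat) (halpha : (1 <= alpha)%N) :
  exists p : {poly int},
    (1 + 5%:R * x) ^+ psi alpha / 5%:R ^+ (alpha %/ 2) * L alpha
      = (map_poly intr p).[x].
Proof.
have [P PE] := L_localized alpha; have [g Lg ag] := L_divisible alpha.
rewrite psi_pole_order // -/x5; move: PE; rewrite Lg.
move: (alpha %/ 2)%N (pole_order alpha) => k n PE.
have U5k : (5%:R ^+ k : qseries) \is a GRing.unit by apply/unitrX/five_unit.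
pose d : {poly int} := 1 + 5%:R *: 'X.
have dE : ev x d = x5 by rewrite rmorphD rmorph1 -mul_polyC rmorphM /= evX evC.
(* Modulo [q^(i + 1)] the cofactor [g] may be replaced by a polynomial [p], and both sides then
   agree as polynomials in [x] up to degree [i]. *)
have P_dvd i : dvd5 k P`_i.
  have [p gp _] := ag i.+1.
  have -> : P`_i = ((5 ^+ k)%:P * (d ^+ n * p))`_i.
    apply: (@ev_eqmod i.+1) => //; rewrite -PE (rmorphM _ (_ ^+ k)%:P) (rmorphM _ (d ^+ n)) /=.
    rewrite evC (rmorphXn (ev x)) /= dE (rmorphXn intr) mulrCA.
    by do 2!apply: fps_eqmodM => //.
  by rewrite mul_polyC coefZ dvdz_mulr.
exists (\poly_(i < size P) (P`_i %/ 5 ^+ k)%Z); rewrite -/(ev x _); set t := \poly_(_ < _) _.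
have Pt : P = (5 ^+ k)%:P * t.
  apply/polyP => i; rewrite mul_polyC coefZ coef_poly; case: ltnP => [_|si].
    by rewrite mulrC divzK.
  by rewrite nth_default ?mulr0.
apply: (mulrI U5k); have <- : ev x P = 5%:R ^+ k * ev x t.
  by rewrite Pt rmorphM /= evC rmorphXn.
rewrite -PE; transitivity (5%:R ^+ k / 5%:R ^+ k * (x5 ^+ n * (5%:R ^+ k * g))).
  by rewrite -[RHS]mulrA; congr (_ * _); rewrite -[LHS]mulrA mulrCA.
by rewrite divrr // mul1r.
Qed.
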